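(* If $\mathbf{GMC}(n)$ (the Gaussian Moments Conjecture in $n$ variables) is true for all $n\ge 1$, then $\mathbf{JC}(n)$ (the Jacobian Conjecture in dimension $n$) is true for all $n\ge 1$.
   Context: For a (complex-valued) random variable $Y$, $\mathbb{E}(Y)$ denotes its expected value. $\mathbf{GMC}(n)$ is the following assertion. Let $X=(X_1,\dots,X_n)$ be a random vector whose components are independent real normal random variables with mean $0$ and variance $1$. If $P\in\mathbb{C}[x_1,\dots,x_n]$ satisfies $\mathbb{E}(P(X)^m)=0$ for all integers $m\ge 1$, then for every $Q\in\mathbb{C}[x_1,\dots,x_n]$ there exists $N$ such that $\mathbb{E}(P(X)^mQ(X))=0$ for all $m\ge N$. $\mathbf{JC}(n)$ is the following assertion. If $F:\mathbb{C}^n\to\mathbb{C}^n$ is a polynomial map that is locally invertible (i.e. its Jacobian determinant vanishes nowhere on $\mathbb{C}^n$), then $F$ is globally invertible (i.e. $F$ is bijective with polynomial inverse). *)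

(* Defs.v *)
From mathcomp Require Import all_boot all_order all_algebra.
From mathcomp Require Import all_classical all_reals all_analysis.
From mathcomp Require Import complex.
(* The notations of mpoly clash with those of mathcomp-analysis. *)
From mathcomp Require Import -(notations) mpoly.

Set Implicit Arguments.
Unset Strict Implicit.
Unset Printing Implicit Defensive.

Import Order.TTheory GRing.Theory Num.Theory.

Local Open Scope classical_set_scope.
Local Open Scope complex_scope.
Local Open Scope ring_scope.

Section Probability.
Context (d : measure_display) (T : measurableType d) (R : realType).
Variable P : probability T R.

(* The equality is restricted to Borel sets because the values of a measure
   on non-measurable sets are not constrained. *)
Definition standard_normal (X : {RV P >-> R}) : Prop :=
  forall A : set R, measurable A -> distribution P X A = normal_prob 0 1 A.

Definition mutually_independent n (X : 'I_n -> {RV P >-> R}) : Prop :=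
  forall (J : {set 'I_n}) (A : 'I_n -> set R),
    (forall i, measurable (A i)) ->
    P (\bigcap_(i in [set` J]) (X i @^-1` A i)) =
      (\prod_(i in J) P (X i @^-1` A i))%E.

(* As [fine] maps infinite values to 0, this is meaningful only for integrable
   Y; polynomials in Gaussian variables have finite moments of all orders. *)
Definition complex_expectation (Y : T -> R[i]) : R[i] :=
  fine 'E_P[fun w => complex.Re (Y w)]%E +i*
  fine 'E_P[fun w => complex.Im (Y w)]%E.

Definition poly_rv n (X : 'I_n -> {RV P >-> R}) (p : mpoly n R[i]) : T -> R[i] :=
  fun w => meval (fun i => (X i w)%:C) p.

End Probability.

Definition GMC (R : realType) (n : nat) : Prop :=
  forall (d : measure_display) (T : measurableType d) (P : probability T R)
         (X : 'I_n -> {RV P >-> R}),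
    (forall i, standard_normal (X i)) ->
    mutually_independent X ->
    forall p : mpoly n R[i],
      (forall m : nat, (1 <= m)%N ->
        complex_expectation P (fun w => poly_rv X p w ^+ m) = 0) ->
      forall q : mpoly n R[i],
        exists N : nat, forall m : nat, (N <= m)%N ->
          complex_expectation P (fun w => poly_rv X p w ^+ m * poly_rv X q w)
            = 0.

Section PolynomialMaps.
Context (K : comNzRingType) (n : nat).

Definition poly_map (F : 'I_n -> mpoly n K) (x : 'rV[K]_n) : 'rV[K]_n :=
  \row_i meval (x ord0) (F i).

Definition jacobian_det (F : 'I_n -> mpoly n K) : mpoly n K :=
  \det (\matrix_(i < n, j < n) mderiv j (F i)).

Definition locally_invertible (F : 'I_n -> mpoly n K) : Prop :=
  forall x : 'rV[K]_n, meval (x ord0) (jacobian_det F) != 0.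

Definition globally_invertible (F : 'I_n -> mpoly n K) : Prop :=
  exists G : 'I_n -> mpoly n K,
    cancel (poly_map F) (poly_map G) /\ cancel (poly_map G) (poly_map F).

End PolynomialMaps.

Definition JC (R : realType) (n : nat) : Prop :=
  forall F : 'I_n -> mpoly n R[i],
    locally_invertible F -> globally_invertible F.

(* Main.v *)
(* Suppose that the Jacobian matrix of H satisfies det(1 - s JH) = 1 for every s.
   The Abhyankar-Gurjar formula inverts z - sH by the power series
   sum_m s^m/m! E((zeta . H)^m z_i), where E(zeta^alpha g) = d^alpha g, and the
   same formula for the constant function 1 gives E((zeta . H)^m) = 0 for all
   m >= 1. Evaluating E(...) at a point a is taking the expectation of the
   polynomial at z = a + Z and zeta = 2 conj(Z), with Z a complex Gaussian
   vector, so GMC makes E((zeta . H)^m z_i)(a) vanish for large m. For a generic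
   a this forces the polynomials themselves to vanish, whence the inverse series
   is a polynomial.

   A map F = z - K_1 - ... - K_r with K_j homogeneous of degree j + 1 and
   constant Jacobian determinant is brought to this form by adding variables
   y_2, ..., y_r and replacing F by
   (z - s(K_1 + y_2), y_2 - s(K_2 + y_3), ..., y_r - s K_r): its Jacobian matrix
   is 1 minus s times a companion matrix, with the determinant of JF at s z. *)
Require Import Defs.
From HB Require Import structures.
From mathcomp Require Import all_boot all_order all_algebra.
From mathcomp Require Import all_classical all_reals all_analysis.
From mathcomp Require Import measurable_realfun.
From mathcomp Require Import complex.
From mathcomp Require Import -(notations) mpoly.
From mathcomp Require Import ring.

Set Implicit Arguments.
Unset Strict Implicit.
Unset Printing Implicit Defensive.

Import Order.TTheory GRing.Theory Num.Theory.
Import numFieldNormedType.Exports.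

Local Open Scope ring_scope.

Local Notation var i := (mpolyX _ (mnm1 i)).

(** * Jacobi's formula and traces of powers of a Jacobian matrix *)

Section DetDerivation.
Context (S : comNzRingType) (D : {additive S -> S}).
Hypothesis derM : forall x y, D (x * y) = D x * y + x * D y.

Lemma derivation1 : D 1 = 0.
Proof.
have := derM 1 1; rewrite !mulr1 mul1r => /(congr1 (fun x => x - D 1)).
by rewrite addrK subrr.
Qed.

Lemma derivation_sign (b : bool) : D ((-1) ^+ b) = 0.
Proof. by case: b; rewrite ?expr1 ?raddfN derivation1 ?oppr0. Qed.

Lemma derivation_prod (I : eqType) (r : seq I) (f : I -> S) : uniq r ->
  D (\prod_(i <- r) f i) =
  \sum_(i <- r) \prod_(j <- r) (if j == i then D (f j) else f j).
Proof.
elim: r => [_|x r IHr /= /andP[xr ur]]; first by rewrite !big_nil derivation1.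
rewrite !big_cons derM eqxx IHr // mulr_sumr; congr (_ * _ + _).
  apply: eq_big_seq => j jr; case: eqP => // jx.
  by rewrite -jx jr in xr.
apply: eq_big_seq => i ir; rewrite big_cons; case: eqP => // xi.
by rewrite xi ir in xr.
Qed.

(** Jacobi's formula. Leibniz's rule differentiates one row at a time, and expansion along that row
    meets only cofactors of [M]. *)
Lemma derivation_det n (M : 'M[S]_n) :
  D (\det M) = \tr (\adj M *m map_mx D M).
Proof.
have -> : \tr (\adj M *m map_mx D M) =
    \sum_i \det (\matrix_(k, j) (if k == i then D (M k j) else M k j)).
  rewrite mxtrace_mulC; apply: eq_bigr => i _.
  rewrite mxE (expand_det_row _ i); apply: eq_bigr => j _.
  rewrite !mxE eqxx; congr (_ * _).
  rewrite /cofactor; congr (_ * \det _).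
  by apply/matrixP => a b; rewrite !mxE eq_sym (negbTE (neq_lift _ _)).
rewrite /determinant raddf_sum exchange_big /=; apply: eq_bigr => s _.
rewrite derM [X in X * _](_ : _ = 0) ?mul0r ?add0r.
  rewrite (derivation_prod _ (index_enum_uniq _)) mulr_sumr.
  apply: eq_bigr => i _; congr (_ * _); apply: eq_bigr => j _.
  by rewrite !mxE.
exact: derivation_sign.
Qed.

Lemma derivation_det1 n (M : 'M[S]_n) (N : 'M[S]_n) : \det M = 1 ->
  N *m M = 1%:M -> \tr (N *m map_mx D M) = 0.
Proof.
move=> dM NM; have -> : N = \adj M; first last.
  by rewrite -derivation_det dM derivation1.
by rewrite -[RHS]mul1mx -NM -mulmxA mul_mx_adj dM mulmx1.
Qed.

End DetDerivation.

Section UnipotentDeterminant.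
Context (A : comNzRingType).

(* In A[s], the inverse of 1 - s J is the adjugate, whose coefficients are the
   powers of J; Jacobi's formula for d/ds kills the trace of each of them
   times J. *)
Lemma tr_exp_eq0 n (J : 'M[A]_n) :
  \det (1%:M - 'X *: map_mx polyC J) = 1 -> forall k, \tr (J ^+ k.+1) = 0.
Proof.
set M := 1%:M - _ => dM.
pose N := \adj M.
have NM : N *m M = 1%:M by rewrite mul_adj_mx dM.
pose c k : 'M[A]_n := \matrix_(i, j) (N i j)`_k.
(* [N (1 - s J) = 1] read as a recursion: [N = 1 + s N J] gives each coefficient from the previous
   one. *)
have NE : N = 1%:M + 'X *: (N *m map_mx polyC J).
  rewrite -[in LHS](subrK ('X *: (N *m map_mx polyC J)) N) -NM.
  by rewrite /M mulmxBr mulmx1 -scalemxAr.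
have mulN k i j : ((N *m map_mx polyC J) i j)`_k = (c k *m J) i j.
  rewrite !mxE coef_sum; apply: eq_bigr => l _.
  by rewrite !mxE coefMC.
have NEij i j :
    N i j = (1%:M : 'M[{poly A}]_n) i j + 'X * (N *m map_mx polyC J) i j.
  by rewrite {1}NE mxE [X in _ + X]mxE.
have cE k : c k = J ^+ k.
  elim: k => [|k IHk]; apply/matrixP => i j; rewrite mxE NEij coefD coefXM.
    by rewrite expr0 !mxE addr0 coefMn coef1.
  by rewrite /= mulN IHk mxE coefMn coef1 mul0rn add0r exprSr.
move=> k; rewrite exprSr -cE.
have /(congr1 (fun p : {poly A} => p`_k)) :=
  derivation_det1 (D := deriv) (@derivM _) dM NM.
have -> : map_mx deriv M = - map_mx polyC J.
  apply/matrixP => i j; rewrite !mxE derivB derivM derivX mul1r derivC mulr0.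
  by rewrite addr0 derivMn derivC mul0rn sub0r.
rewrite mulmxN linearN /= coef0 coefN => /eqP; rewrite oppr_eq0 => /eqP <-.
by rewrite /mxtrace coef_sum; apply: eq_bigr => i _; rewrite mulN.
Qed.

End UnipotentDeterminant.

(** * Divergences and the Abhyankar-Gurjar operators *)

Section Divergence.
Context (K : comNzRingType) (n : nat).
Local Notation A := (mpoly n K).

Definition jacobian_mx (H : 'I_n -> A) : 'M[A]_n :=
  \matrix_(i, j) mderiv j (H i).

Definition divergence (w : 'cV[A]_n) : A := \sum_i mderiv i (w i 0).

Lemma mderivU i j : mderiv i (mpolyX K (mnm1 j)) = (i == j)%:R :> A.
Proof.
rewrite mderivX mnm1E eq_sym; case: eqP => [->|_]; last by rewrite scale0r.
by rewrite scale1r -{1}[mnm1 _]add0m addmK mpolyX0.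
Qed.

Lemma divergence_mul (M : 'M[A]_n) (w : 'cV[A]_n) :
  divergence (M *m w) = \sum_j (\sum_i mderiv i (M i j)) * w j 0 +
                        \tr (M *m \matrix_(i, j) mderiv j (w i 0)).
Proof.
rewrite /divergence.
under eq_bigr => i _.
  rewrite mxE raddf_sum /=.
  under eq_bigr => j _ do rewrite mderivM.
  over.
rewrite (eq_bigr _ (fun i _ => big_split _ _ _ _ _)) big_split /=.
congr (_ + _).
  rewrite exchange_big; apply: eq_bigr => j _ /=.
  by rewrite mulr_suml.
apply: eq_bigr => i _; rewrite mxE; apply: eq_bigr => j _.
by rewrite mxE.
Qed.

Lemma mderiv_mx_mul i m p (M : 'M[A]_(m, n)) (N : 'M[A]_(n, p)) :
  map_mx (mderiv i) (M *m N) =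
  map_mx (mderiv i) M *m N + M *m map_mx (mderiv i) N.
Proof.
apply/matrixP => a b; rewrite !mxE raddf_sum -big_split /=.
by apply: eq_bigr => j _; rewrite !mxE mderivM.
Qed.

(** Leibniz's rule gives [k + 1] terms, which cyclicity of the trace makes equal. *)
Lemma mderiv_tr_exp i (M : 'M[A]_n) k :
  mderiv i (\tr (M ^+ k.+1)) = \tr (M ^+ k *m map_mx (mderiv i) M) *+ k.+1.
Proof.
(* The left factor [M ^+ p] absorbs the copies of [M] that cyclicity carries around the trace. *)
have claim p q : \tr (M ^+ p *m map_mx (mderiv i) (M ^+ q.+1)) =
    \tr (M ^+ (p + q) *m map_mx (mderiv i) M) *+ q.+1.
  elim: q p => [|q IHq] p; first by rewrite expr1 addn0 mulr1n.
  rewrite exprSr mderiv_mx_mul mulmxDr linearD /= !mulmxA mxtrace_mulC mulmxA.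
  rewrite -[M *m M ^+ p]/(M * M ^+ p) -exprS IHq addSnnS [RHS]mulrSr.
  by rewrite -[M ^+ p *m M ^+ q.+1]/(M ^+ p * M ^+ q.+1) -exprD.
have := claim 0 k; rewrite expr0 mul1mx add0n => <-.
by rewrite /mxtrace raddf_sum; apply: eq_bigr => j _; rewrite !mxE.
Qed.

End Divergence.

Section AbhyankarGurjar.
Context (K : comNzRingType) (n : nat).
Local Notation A := (mpoly n K).
Variable H : 'I_n -> A.

(* [ag m u] is the sum of m!/alpha! d^alpha (H^alpha u) over |alpha| = m. *)
Fixpoint ag m (u : A) : A :=
  if m is m'.+1 then \sum_i mderiv i (ag m' (H i * u)) else u.

Lemma ag_is_linear m : linear (ag m).
Proof.
elim: m => [//|m IHm] c u v /=; rewrite scaler_sumr -big_split /=.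
apply: eq_bigr => i _.
by rewrite mulrDr -scalerAr IHm mderivD mderivZ.
Qed.

HB.instance Definition _ m :=
  GRing.isLinear.Build K A A *:%R (ag m) (@ag_is_linear m).

(** Each of the [m] derivatives may hit the new variable; it must then have index [i], and its
    factor [H i] stays behind. At [m = 0], where [m.-1] is 0, the last term has multiplicity 0. *)
Lemma agX m i u : ag m (mpolyX K (mnm1 i) * u) =
  mpolyX K (mnm1 i) * ag m u + ag m.-1 (H i * u) *+ m.
Proof.
elim: m u => [|m IHm] u /=; first by rewrite addr0.
under eq_bigr => k _ do
  rewrite mulrCA IHm mderivD mderivM mderivMn mderivU (mulrCA (H i)).
rewrite 2!big_split /= -mulr_sumr sumrMnl -addrA addrCA; congr (_ + _).
rewrite (bigD1 i) //= eqxx mul1r big1 ?addr0; last first.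
  by move=> k /negbTE ->; rewrite mul0r.
rewrite mulrS; congr (_ + _).
by case: m IHm => [|m] _; rewrite ?mulr0n.
Qed.

(** The derivative commutes with the outer ones and falls either on [u] or on one of the [m] factors
    [H i]. *)
Lemma mderiv_ag m j u : mderiv j (ag m u) = ag m (mderiv j u) +
  (\sum_i mderiv i (ag m.-1 (mderiv j (H i) * u))) *+ m.
Proof.
elim: m u => [|m IHm] u /=; first by rewrite addr0.
rewrite raddf_sum /=.
under eq_bigr => k _ do
  rewrite mderiv_comm IHm mderivM !raddfD /= raddfMn /= raddf_sum.
rewrite !big_split /= -addrA addrCA; congr (_ + _).
rewrite mulrS; congr (_ + _); rewrite sumrMnl.
case: m {IHm} => [|m]; first by rewrite !mulr0n.
congr (_ *+ _); rewrite exchange_big /=; apply: eq_bigr => i _.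
rewrite raddf_sum; apply: eq_bigr => k _.
by rewrite mderiv_comm mulrCA.
Qed.

(** Summed over the components of [w], the terms in which a factor [H i] is differentiated assemble
    into [JH w], one order lower; this is the recursion behind [ag_1]. *)
Lemma ag_divergence m (w : 'cV[A]_n) :
  \sum_j mderiv j (ag m (w j 0)) = ag m (divergence w) +
  (\sum_i mderiv i (ag m.-1 ((jacobian_mx H *m w) i 0))) *+ m.
Proof.
under eq_bigr => j _ do rewrite mderiv_ag.
rewrite big_split /= raddf_sum sumrMnl exchange_big /=; congr (_ + _ *+ _).
apply: eq_bigr => i _; rewrite -raddf_sum; congr mderiv.
by rewrite mxE raddf_sum; apply: eq_bigr => j _; rewrite mxE.
Qed.

End AbhyankarGurjar.

Section NilpotentJacobian.
Context (K : numFieldType) (n : nat).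
Local Notation A := (mpoly n K).
Variable H : 'I_n -> A.
Hypothesis unipotent :
  \det (1%:M - 'X *: map_mx polyC (jacobian_mx H)) = 1.

(** The columns of every power of [JH] are divergence free, so [divergence_mul] leaves only the
    trace of [JH^(k+1)]. *)
Lemma divergence_jacobian_exp k :
  divergence (jacobian_mx H ^+ k *m \col_i H i) = 0.
Proof.
have tr0 := tr_exp_eq0 unipotent.
have tr_deriv0 j p : \tr (jacobian_mx H ^+ p *m
    map_mx (mderiv j) (jacobian_mx H)) = 0.
  have /eqP := mderiv_tr_exp j (jacobian_mx H) p.
  rewrite tr0 raddf0 eq_sym -scaler_nat scaler_eq0 pnatr_eq0 /=.
  by move/eqP.
(* Symmetry of second derivatives turns the Jacobian matrix of column [j] of [JH] into [mderiv j] of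
   [JH], so that [tr_deriv0] applies. *)
have cols0 p j : \sum_i mderiv i ((jacobian_mx H ^+ p) i j) = 0.
  elim: p j => [|p IHp] j.
    rewrite big1 // => i _.
    by rewrite expr0 mxE raddfMn /= -mpolyC1 mderivC mul0rn.
  rewrite exprSr.
  transitivity (divergence (jacobian_mx H ^+ p *m col j (jacobian_mx H))).
    apply: eq_bigr => i _; congr mderiv; rewrite !mxE.
    by apply: eq_bigr => a _; rewrite !mxE.
  rewrite divergence_mul big1 ?add0r => [|a _]; last by rewrite IHp mul0r.
  rewrite -[RHS](tr_deriv0 j p); congr (\tr (_ *m _)).
  by apply/matrixP => a b; rewrite !mxE mderiv_comm.
rewrite divergence_mul big1 ?add0r => [|j _]; last by rewrite cols0 mul0r.
rewrite -[RHS](tr0 k) exprSr; congr (\tr (_ *m _)).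
by apply/matrixP => a b; rewrite !mxE.
Qed.

(** On the divergence-free fields [JH^k H], each use of [ag_divergence] trades one order of the
    operator for one power of [JH], down to order 0. *)
Lemma ag_1 m : ag H m.+1 1 = 0.
Proof.
have claim k :
    \sum_i mderiv i (ag H m ((jacobian_mx H ^+ k *m \col_i H i) i 0)) = 0.
  elim: m k => [|m IHm] k; rewrite ag_divergence divergence_jacobian_exp.
    by rewrite raddf0 addr0.
  by rewrite raddf0 add0r mulmxA -[_ *m _ ^+ k]/(_ * _) -exprS IHm mul0rn.
rewrite -[RHS](claim 0) /=; apply: eq_bigr => i _.
by rewrite expr0 mul1mx mxE mulr1.
Qed.

End NilpotentJacobian.

Section MpolyInduction.
Context (K : comNzRingType) (n : nat).
Local Notation A := (mpoly n K).

Lemma mpoly_alg_ind (P : A -> Prop) :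
  (forall c, P (mpolyC n c)) -> (forall i, P (var i)) ->
  (forall p q, P p -> P q -> P (p + q)) ->
  (forall p q, P p -> P q -> P (p * q)) -> forall p, P p.
Proof.
move=> PC PX PD PM; elim/mpolyind => [|c m p _ _ Pp].
  by rewrite -(mpolyC0 n K).
apply: (PD) Pp; rewrite -mul_mpolyC; apply: (PM) => //.
rewrite mpolyXE_id; elim/big_rec: _ => [|i q _ Pq].
  by rewrite -mpolyC1.
apply: (PM) Pq; elim: (m i) => [|k IHk]; first by rewrite expr0 -mpolyC1.
by rewrite exprS; apply: PM.
Qed.

Lemma mmapXU (S : comNzRingType) (f : {rmorphism K -> S}) (h : 'I_n -> S) i :
  mmap f h (var i) = h i.
Proof. by rewrite mmapX mmap1U. Qed.

Lemma mpoly_rmorph_ext (S : pzRingType) (f g : {rmorphism A -> S}) :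
  (forall c, f (mpolyC n c) = g (mpolyC n c)) ->
  (forall i, f (var i) = g (var i)) -> f =1 g.
Proof.
move=> fgC fgX; elim/mpoly_alg_ind => // p q pE qE.
  by rewrite !rmorphD pE qE.
by rewrite !rmorphM pE qE.
Qed.

End MpolyInduction.

Lemma factS_inv_scale (K : numFieldType) (V : lmodType K) m (v : V) :
  ((m.+1)`!%:R : K)^-1 *: (v *+ m.+1) = (m`!%:R : K)^-1 *: v.
Proof.
rewrite -scalerMnr scalerMnl -mulr_natr factS natrM invfM mulrAC mulVf.
  by rewrite mul1r.
by rewrite pnatr_eq0.
Qed.

(** * Inverting a substitution by a series of operators *)

Section SeriesOperator.
Context (A : comNzRingType) (U : nat -> {additive A -> A}).
Hypothesis U0 : forall u, U 0 u = u.

(* The coefficient of s^m in \sum_k s^k U_k, applied to u in A[s]. *)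
Definition series_op m (u : {poly A}) : A := \sum_(k < m.+1) U (m - k) u`_k.

Lemma series_op_is_additive m : additive (series_op m).
Proof.
move=> u v; rewrite /series_op -sumrB; apply: eq_bigr => k _.
by rewrite coefB raddfB.
Qed.

HB.instance Definition _ m :=
  GRing.isAdditive.Build {poly A} A (series_op m) (@series_op_is_additive m).

Lemma series_op_recr m u :
  series_op m u = \sum_(k < m) U (m - k) u`_k + u`_m.
Proof. by rewrite /series_op big_ord_recr /= subnn U0. Qed.

Lemma series_op0 u : series_op 0 u = u`_0.
Proof. by rewrite series_op_recr big_ord0 add0r. Qed.

Lemma series_opX u m :
  series_op m ('X * u) = if m is m'.+1 then series_op m' u else 0.
Proof.
rewrite /series_op big_ord_recl coefXM /= raddf0 add0r.
case: m => [|m]; first by rewrite big_ord0.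
by apply: eq_bigr => k _; rewrite coefXM.
Qed.

Lemma series_opXn u k m :
  series_op m ('X^k * u) = if (k <= m)%N then series_op (m - k) u else 0.
Proof.
elim: k m => [|k IHk] m; first by rewrite expr0 mul1r subn0.
by rewrite exprS -mulrA series_opX; case: m => // m; rewrite IHk.
Qed.

(** The commutator of [U m.+1] with [x] is [U m] after multiplication by [h]; the factor s in front
    of [h] shifts the order by one, and the two cancel. *)
Lemma series_op_mul (x h : A) :
  (forall m u, U m.+1 (x * u) = x * U m.+1 u + U m (h * u)) ->
  forall u m, series_op m ((x%:P - 'X * h%:P) * u) = x * series_op m u.
Proof.
move=> UXS u m; rewrite mulrBl -mulrA raddfB /= series_opX.
case: m => [|m]; first by rewrite subr0 !series_op0 coefCM.
apply/eqP; rewrite subr_eq; apply/eqP.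
rewrite 2!series_op_recr mulrDr coefCM addrAC; congr (_ + _).
rewrite mulr_sumr /series_op -big_split /=; apply: eq_bigr => k _.
by rewrite !coefCM subSn ?UXS // -ltnS.
Qed.

(** As [U 0] is the identity, the operator is unitriangular on coefficients. *)
Lemma series_op_inj u v : series_op^~ u =1 series_op^~ v -> u = v.
Proof.
move=> uv; apply/polyP => m; elim/ltn_ind: m => m IHm.
have := uv m; rewrite /= !series_op_recr.
rewrite (eq_bigr (fun k : 'I_m => U (m - k) v`_k)) => [/addrI //|k _].
by rewrite IHm.
Qed.

Variable V : {rmorphism A -> {poly A}}.

Lemma series_op_mulD g h :
  (forall u m, series_op m (V g * u) = g * series_op m u) ->
  (forall u m, series_op m (V h * u) = h * series_op m u) ->
  forall u m, series_op m (V (g + h) * u) = (g + h) * series_op m u.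
Proof. by move=> Hg Hh u m; rewrite rmorphD mulrDl raddfD /= Hg Hh mulrDl. Qed.

Lemma series_op_mulM g h :
  (forall u m, series_op m (V g * u) = g * series_op m u) ->
  (forall u m, series_op m (V h * u) = h * series_op m u) ->
  forall u m, series_op m (V (g * h) * u) = (g * h) * series_op m u.
Proof. by move=> Hg Hh u m; rewrite rmorphM -!mulrA Hg Hh. Qed.

Hypothesis U1 : forall m, U m.+1 1 = 0.
Hypothesis series_opV :
  forall g u m, series_op m (V g * u) = g * series_op m u.

(** Evaluation at ['X] extends [V] to an endomorphism of A[s] fixing s. The operator series sends
    [V g] to [g] times its value at 1, which is 1 by [U1], and powers of s pass through it. *)
Lemma series_op_map_poly u m : series_op m (map_poly V u).['X] = u`_m.
Proof.
have V1 g k : series_op k (V g) = if k is 0%N then g else 0.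
  rewrite -[V g]mulr1 series_opV series_op_recr coef1 big1 => [|j _].
    by rewrite add0r; case: k => [|k]; rewrite ?mulr1 ?mulr0.
  by rewrite coef1; case: j => -[|j] jm /=;
    rewrite ?raddf0 // subn0 -(prednK jm) U1.
rewrite -[u in LHS]coefK poly_def [map_poly _ _]rmorph_sum horner_sum /=.
rewrite raddf_sum /=.
under eq_bigr => k _.
  rewrite -mul_polyC rmorphM /= map_polyC map_polyXn hornerCM hornerXn mulrC.
  rewrite series_opXn V1 (_ : (if _ then _ else _) =
    if k == m :> nat then u`_m else 0).
    over.
  case: ltngtP => [km|//|->]; last by rewrite subnn.
  by rewrite -(subnSK km).
have [mu|um] := ltnP m (size u).
  rewrite (bigD1 (Ordinal mu)) //= eqxx big1 ?addr0 // => k /negbTE.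
  by rewrite -val_eqE /= => ->.
rewrite big1 => [|k _]; first by rewrite nth_default.
by rewrite ltn_eqF // (leq_trans _ um).
Qed.

Lemma map_poly_horner_inj : injective (fun u => (map_poly V u).['X]).
Proof. by move=> u v uv; apply/polyP => m; rewrite -!series_op_map_poly uv. Qed.

(** Both sides have the same image under the injective operator series, the sum of the [s^m U m x];
    the bound [N] makes it a polynomial. *)
Lemma map_poly_horner_series x N : (forall m, (N <= m)%N -> U m x = 0) ->
  (map_poly V (\poly_(m < N) U m x)).['X] = x%:P.
Proof.
move=> UN; apply: series_op_inj => m; rewrite series_op_map_poly coef_poly.
rewrite /series_op big_ord_recl subn0 coefC /= big1 => [|k _].
  by rewrite addr0; case: ltnP => // /UN.
by rewrite coefC raddf0.
Qed.

End SeriesOperator.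

(** * The polynomial inverse of z - H *)

Section FormalInverse.
Context (K : numFieldType) (n : nat).
Local Notation A := (mpoly n K).
Variable H : 'I_n -> A.

(* The coefficient of s^m in the Abhyankar-Gurjar series of u. *)
Definition ag_coef m (u : A) : A := (m`!%:R : K)^-1 *: ag H m u.

Lemma ag_coef_is_linear m : linear (ag_coef m).
Proof.
by move=> c u v; rewrite /ag_coef ag_is_linear scalerDr !scalerA mulrC.
Qed.

HB.instance Definition _ m :=
  GRing.isLinear.Build K A A *:%R (ag_coef m) (@ag_coef_is_linear m).

Lemma ag_coef0 u : ag_coef 0 u = u.
Proof. by rewrite /ag_coef fact0 invr1 scale1r. Qed.

Lemma ag_coefXS m i u :
  ag_coef m.+1 (var i * u) = var i * ag_coef m.+1 u + ag_coef m (H i * u).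
Proof.
rewrite /ag_coef agX scalerDr scalerAr; congr (_ + _).
exact: factS_inv_scale.
Qed.

Definition scaled_map : A -> {poly A} :=
  mmap (polyC \o @mpolyC n K) (fun i => (var i)%:P - 'X * (H i)%:P).

HB.instance Definition _ := GRing.RMorphism.on scaled_map.

Lemma scaled_mapX i : scaled_map (var i) = (var i)%:P - 'X * (H i)%:P.
Proof. exact: mmapXU. Qed.

Lemma scaled_mapC c : scaled_map (mpolyC n c) = (mpolyC n c)%:P.
Proof. exact: mmapC. Qed.

(** The [g] with this property form a subalgebra, and [ag_coefXS] puts the variables in it. *)
Lemma series_op_scaled_map g u m :
  series_op ag_coef m (scaled_map g * u) = g * series_op ag_coef m u.
Proof.
move: u m; elim/mpoly_alg_ind: g => [c|i|p q IHp IHq|p q IHp IHq] u m.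
- rewrite scaled_mapC /series_op mulr_sumr; apply: eq_bigr => k _.
  by rewrite /= coefCM !mul_mpolyC linearZ.
- rewrite scaled_mapX.
  by apply: series_op_mul ag_coef0 _ _ _ _ _ => *; apply: ag_coefXS.
- exact: series_op_mulD IHp IHq u m.
- exact: series_op_mulM IHp IHq u m.
Qed.

Hypothesis unipotent :
  \det (1%:M - 'X *: map_mx polyC (jacobian_mx H)) = 1.

Hypothesis ag_X_eventually0 :
  forall i, exists N, forall m, (N <= m)%N -> ag H m (var i) = 0.

(** Eventual vanishing makes the series [G i] of each variable a polynomial in s. It inverts z - s H
    on both sides over K[s], and s = 1 gives the inverse. *)
Lemma unipotent_globally_invertible :
  globally_invertible (fun i => var i - H i).
Proof.
have [N NP] := choice ag_X_eventually0.
have ag_coef1 m : ag_coef m.+1 1 = 0 by rewrite /ag_coef ag_1 // scaler0.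
(* [V] fixes s and substitutes z - s H for z; [T] below substitutes [G] for z. *)
pose V : {rmorphism {poly A} -> {poly A}} := horner_eval 'X \o map_poly scaled_map.
have Vinj : injective V.
  exact: (map_poly_horner_inj (U := ag_coef) ag_coef0 ag_coef1
    series_op_scaled_map).
have VC g : V g%:P = scaled_map g by rewrite /V /= map_polyC /horner_eval hornerC.
pose G i : {poly A} := \poly_(m < N i) ag_coef m (var i).
have VG i : V (G i) = (var i)%:P.
  apply: (map_poly_horner_series (U := ag_coef) ag_coef0 ag_coef1
    series_op_scaled_map) => m /NP agX0.
  by rewrite /= /ag_coef agX0 scaler0.
pose T : {rmorphism A -> {poly A}} := mmap (polyC \o @mpolyC n K) G.
have TC c : T (mpolyC n c) = (mpolyC n c)%:P by exact: mmapC.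
have TX i : T (var i) = G i by exact: mmapXU.
have VT g : V (T g) = g%:P.
  apply: (mpoly_rmorph_ext (f := V \o T) (g := polyC)) => [c|i].
    change (V (T (mpolyC n c)) = (mpolyC n c)%:P).
    by rewrite TC VC scaled_mapC.
  by change (V (T (var i)) = (var i)%:P); rewrite TX VG.
(* [V] maps both sides to [var i - s H i] and is injective, so the left inverse is also a right
   inverse. *)
have GE i : G i - 'X * T (H i) = (var i)%:P.
  apply: Vinj; rewrite (rmorphB V) (rmorphM V) VG VT VC scaled_mapX.
  by rewrite /V /= map_polyX /horner_eval hornerX.
exists (fun i => (G i).[1]); split=> x; apply/rowP => i; rewrite !mxE.
- pose Fx := (fun i => x ord0 i - meval (x ord0) (H i)).
  have evV u : meval (x ord0) (V u).[1] = meval Fx u.[1].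
    elim/poly_ind: u => [|u c IHu].
      by rewrite rmorph0 !horner0 !meval0.
    rewrite (rmorphD V) (rmorphM V) VC !hornerD !hornerM.
    have -> : V 'X = 'X by rewrite /V /= map_polyX /horner_eval hornerX.
    rewrite hornerX !mulr1 hornerC !mevalD IHu; congr (_ + _).
    apply: (mpoly_rmorph_ext
      (f := meval (x ord0) \o horner_eval 1 \o scaled_map) (g := meval Fx)) => [a|j] /=.
      by rewrite scaled_mapC /horner_eval hornerC !mevalC.
    rewrite scaled_mapX /horner_eval hornerD hornerN hornerM hornerX !hornerC.
    by rewrite mul1r mevalB !mevalXU.
  transitivity (meval Fx (G i).[1]).
    by apply: meval_eq => j; rewrite mxE mevalB mevalXU.
  by rewrite -evV VG hornerC mevalXU.
- have := congr1 (fun p : {poly A} => meval (x ord0) p.[1]) (GE i).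
  rewrite hornerD hornerN hornerM hornerX mul1r hornerC mevalXU => <-.
  rewrite !mevalB mevalXU mxE; congr (_ - _).
  apply/esym; apply: (mpoly_rmorph_ext
      (f := meval (x ord0) \o horner_eval 1 \o T) (g := meval _)) => [c|j] /=.
    by rewrite TC /horner_eval hornerC !mevalC.
  by rewrite TX mevalXU mxE.
Qed.

End FormalInverse.

Section Substitution.
Context (K : comNzRingType).

Definition subst_mpoly n m (h : 'I_n -> mpoly m K) : mpoly n K -> mpoly m K :=
  mmap (@mpolyC m K) h.

HB.instance Definition _ n m h := GRing.RMorphism.on (@subst_mpoly n m h).

Lemma subst_mpolyX n m (h : 'I_n -> mpoly m K) i :
  subst_mpoly h (var i) = h i.
Proof. exact: mmapXU. Qed.

Lemma subst_mpolyC n m (h : 'I_n -> mpoly m K) c :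
  subst_mpoly h (mpolyC n c) = mpolyC m c.
Proof. exact: mmapC. Qed.

Lemma meval_subst n m (h : 'I_n -> mpoly m K) v p :
  meval v (subst_mpoly h p) = meval (fun i => meval v (h i)) p.
Proof.
apply: (mpoly_rmorph_ext (f := meval v \o subst_mpoly h) (g := meval _)).
  by move=> c /=; rewrite subst_mpolyC !mevalC.
by move=> i /=; rewrite subst_mpolyX mevalXU.
Qed.

End Substitution.

(** * Points avoiding countably many hypersurfaces *)

Section GenericPoint.
Context (K : closedFieldType) (n : nat).
Local Notation A := (mpoly n K).
Hypothesis uncountable :
  forall S : nat -> seq K, exists c, forall j, c \notin S j.

Let spec i c : A -> A :=
  subst_mpoly (fun j => if j == i then mpolyC n c else var j).

Let spec_nonzero i (p : A) : p != 0 ->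
  exists s : seq K, forall c, c \notin s -> spec i c p != 0.
Proof.
move=> p0.
pose psi : {rmorphism A -> {poly A}} := mmap (polyC \o @mpolyC n K)
  (fun j => if j == i then 'X else (var j)%:P).
have psiC c : psi (mpolyC n c) = (mpolyC n c)%:P by exact: mmapC.
have psiX j : psi (var j) = if j == i then 'X else (var j)%:P by exact: mmapXU.
have psi_spec c q : (psi q).[mpolyC n c] = spec i c q.
  apply: (mpoly_rmorph_ext (f := horner_eval (mpolyC n c) \o psi)
    (g := spec i c)) => [a|j]; rewrite /= /horner_eval.
    by rewrite psiC hornerC /spec subst_mpolyC.
  rewrite psiX /spec subst_mpolyX; case: eqP => _; first by rewrite hornerX.
  by rewrite hornerC.
have psi0 : psi p != 0.
  apply: contra_neq p0 => psi0.
  have -> : p = (psi p).[var i]; last by rewrite psi0 horner0.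
  apply/esym; apply: (mpoly_rmorph_ext (f := horner_eval (var i) \o psi)
    (g := idfun)) => [a|j]; rewrite /= /horner_eval.
    by rewrite psiC hornerC.
  by rewrite psiX; case: eqP => [->|_]; rewrite ?hornerX ?hornerC.
have [k pk0] : exists k, (psi p)`_k != 0.
  by exists (size (psi p)).-1; rewrite -lead_coefE lead_coef_eq0.
have [m pkm0] : exists m, mcoeff m (psi p)`_k != 0.
  apply/not_existsP => all0; case/eqP: pk0; apply/mpolyP => m.
  by rewrite mcoeff0; apply/eqP; apply/negPn/negP/all0.
(* [r] gathers the coefficients of the single monomial [m], so [r.[c]] is one coefficient of
   [spec i c p], which can therefore vanish only at the finitely many roots of [r]. *)
pose r : {poly K} := \poly_(l < size (psi p)) mcoeff m (psi p)`_l.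
have r0 : r != 0.
  apply/eqP => /(congr1 (fun q : {poly K} => q`_k)); rewrite coef0 coef_poly.
  case: ltnP => [_ /eqP|sk _]; first by rewrite (negbTE pkm0).
  by rewrite nth_default ?eqxx // in pk0.
have rE c : r.[c] = mcoeff m (spec i c p).
  rewrite -psi_spec /r horner_poly horner_coef raddf_sum /=.
  apply: eq_bigr => l _.
  by rewrite -rmorphXn /= [in RHS]mulrC mul_mpolyC mcoeffZ mulrC.
have [s rs] := closed_field_poly_normal r.
exists s => c cs; apply: contra cs => /eqP spec0.
have : root r c by rewrite /root rE spec0 mcoeff0.
by rewrite rs rootZ ?lead_coef_eq0 // root_prod_XsubC.
Qed.

(** Variables are specialized one at a time, each step avoiding countably many finite sets of bad
    values, one for each polynomial. *)
Lemma generic_point (q : nat -> A) :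
  exists v, forall j, q j != 0 -> meval v (q j) != 0.
Proof.
have step i (p : nat -> A) : exists c, forall j, p j != 0 -> spec i c (p j) != 0.
  have /choice [S HS] : forall j, exists s : seq K,
      p j != 0 -> forall c, c \notin s -> spec i c (p j) != 0.
    move=> j; have [->|pj0] := eqVneq (p j) 0; first by exists [::].
    by have [s ?] := spec_nonzero i pj0; exists s.
  have [c Hc] := uncountable S.
  by exists c => j pj; apply: HS.
have partial (s : seq 'I_n) (p : nat -> A) : exists v, forall j, p j != 0 ->
    subst_mpoly (fun k => if k \in s then mpolyC n (v k) else var k) (p j) != 0.
  elim: s p => [|i s IHs] p.
    exists (fun=> 0) => j; apply: contra_neq => <-.
    apply/esym; apply: (mpoly_rmorph_ext (f := subst_mpoly _) (g := idfun)) => /=.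
      by move=> c; rewrite subst_mpolyC.
    by move=> k; rewrite subst_mpolyX.
  have [c Hc] := step i p; have [v Hv] := IHs (fun j => spec i c (p j)).
  exists (fun k => if k == i then c else v k) => j /Hc /Hv.
  apply: contra_neq => <-.
  apply: (mpoly_rmorph_ext (f := subst_mpoly _ \o spec i c)
    (g := subst_mpoly _)) => /=.
    by move=> a; rewrite /spec !subst_mpolyC.
  move=> k; rewrite /spec !subst_mpolyX inE; case: eqP => _ /=.
    by rewrite subst_mpolyC.
  by rewrite subst_mpolyX.
have [v Hv] := partial (enum 'I_n) q; exists v => j /Hv.
apply: contra_neq => qv0; rewrite -(mpolyC0 n K) -qv0.
apply: (mpoly_rmorph_ext (f := subst_mpoly _) (g := @mpolyC n K \o meval v)) => /=.
  by move=> c; rewrite subst_mpolyC mevalC.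
by move=> k; rewrite subst_mpolyX mevalXU mem_enum.
Qed.

(** On a line through the origin [p] has no root in an algebraically closed field, so it is constant
    there. Hence [p] takes the value [p(0)] everywhere, and [generic_point] turns this into equality
    of polynomials. *)
Lemma nonvanishing_mpolyC (p : A) : (forall v, meval v p != 0) ->
  p = mpolyC n (meval (fun=> 0) p).
Proof.
move=> p0.
have cst v : meval v p = meval (fun=> 0) p.
  pose g : {rmorphism A -> {poly K}} := mmap polyC (fun i => (v i)%:P * 'X).
  have gE t : (g p).[t] = meval (fun i => v i * t) p.
    apply: (mpoly_rmorph_ext (f := horner_eval t \o g) (g := meval _)) => [c|i];
      rewrite /= /horner_eval.
      by rewrite [g _]mmapC hornerC mevalC.
    by rewrite [g _]mmapXU hornerCM hornerX mevalXU.
  have : size (g p) == 1%N.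
    apply/negPn/negP => /closed_rootP [t]; rewrite /root gE.
    by rewrite (negbTE (p0 _)).
  move=> /size_poly1P [c _ gc].
  transitivity (g p).[1].
    by rewrite gE; apply: meval_eq => i; rewrite mulr1.
  transitivity (g p).[0]; first by rewrite gc !hornerC.
  by rewrite gE; apply: meval_eq => i; rewrite mulr0.
apply/eqP; rewrite -subr_eq0; apply/negPn/negP => d0.
have [v /(_ 0 d0)] := generic_point (fun=> p - mpolyC n (meval (fun=> 0) p)).
by rewrite mevalB mevalC cst subrr eqxx.
Qed.

End GenericPoint.

(** * Lowering the degree in the parameter s by doubling the variables *)

Section MapDerivation.
Context (A : nzRingType) (D : {additive A -> A}).
Hypothesis derM : forall x y, D (x * y) = D x * y + x * D y.

Lemma map_poly_derM (p q : {poly A}) :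
  map_poly D (p * q) = map_poly D p * q + p * map_poly D q.
Proof.
apply/polyP => k; rewrite coefD !coefM coef_map /= coefM raddf_sum -big_split.
by apply: eq_bigr => j _; rewrite /= derM !coef_map.
Qed.

End MapDerivation.

Lemma mderiv_subst_lshift (K : comNzRingType) n m (j : 'I_n) (p : mpoly n K) :
  mderiv (lshift m j) (subst_mpoly (fun i => var (lshift m i)) p) =
  subst_mpoly (fun i => var (lshift m i)) (mderiv j p).
Proof.
elim/mpoly_alg_ind: p => [c|i|p q IHp IHq|p q IHp IHq].
- by rewrite subst_mpolyC !mderivC rmorph0.
- by rewrite subst_mpolyX !mderivU (inj_eq (@lshift_inj _ _)) rmorph_nat.
- by rewrite rmorphD /= !mderivD rmorphD /= IHp IHq.
- by rewrite rmorphM /= !mderivM rmorphD /= !rmorphM /= IHp IHq.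
Qed.

Lemma mderiv_subst_rshift (K : comNzRingType) n m (j : 'I_m) (p : mpoly n K) :
  mderiv (rshift n j) (subst_mpoly (fun i => var (lshift m i)) p) = 0.
Proof.
elim/mpoly_alg_ind: p => [c|i|p q IHp IHq|p q IHp IHq].
- by rewrite subst_mpolyC !mderivC.
- by rewrite subst_mpolyX !mderivU eq_rlshift.
- by rewrite rmorphD /= !mderivD IHp IHq addr0.
- by rewrite rmorphM /= !mderivM IHp IHq mul0r mulr0 addr0.
Qed.

Lemma det_block1 (S : comNzRingType) n (M N P : 'M[S]_n) :
  \det (block_mx M N P 1%:M) = \det (M - N *m P).
Proof.
have /(congr1 determinant) : block_mx M N P 1%:M *m block_mx 1%:M 0 (- P) 1%:M =
    block_mx (M - N *m P) N 0 1%:M.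
  rewrite mulmx_block !mulmx1 !mulmx0 !mul1mx add0r mulmxN.
  by rewrite subrr !add0r.
by rewrite det_mulmx det_lblock det_ublock !det1 !mulr1.
Qed.

Lemma map_poly_size1 (A B : nzRingType) (f : {additive A -> B}) (p : {poly A}) :
  (size p <= 1)%N -> map_poly f p = (f p`_0)%:P.
Proof. by move=> /size1_polyC {1}->; rewrite map_polyC. Qed.

Lemma horner1_drop (A : nzRingType) (p : {poly A}) :
  p.[1] = p`_0 + (drop_poly 1 p).[1].
Proof.
rewrite -[in LHS](poly_take_drop 1 p) hornerD expr1 hornerMX mulr1.
rewrite (size1_polyC (size_take_poly 1 p)) hornerC coef_take_poly.
by [].
Qed.

Section Linearization.
Context (K : numFieldType).

Definition family_jacobian n (H : 'I_n -> {poly mpoly n K}) :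
    'M[{poly mpoly n K}]_n :=
  \matrix_(i, j) map_poly (mderiv j) (H i).

Section Doubling.
Context (n : nat) (H : 'I_n -> {poly mpoly n K}).

Let iota : mpoly n K -> mpoly (n + n) K := subst_mpoly (fun i => var (lshift n i)).

(* H = H_0 + s H' becomes (H_0(z) + y, H'(z, s)), which lowers the degree in
   s; eliminating y = s H' gives back z - s H(z, s). *)
Definition doubled_family (k : 'I_(n + n)) : {poly mpoly (n + n) K} :=
  match fintype.split k with
  | inl i => (iota (H i)`_0 + var (rshift n i))%:P
  | inr i => map_poly iota (drop_poly 1 (H i))
  end.

Lemma doubled_familyL i :
  doubled_family (lshift n i) = (iota (H i)`_0 + var (rshift n i))%:P.
Proof. by rewrite /doubled_family (unsplitK (inl i)). Qed.

Lemma doubled_familyR i :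
  doubled_family (rshift n i) = map_poly iota (drop_poly 1 (H i)).
Proof. by rewrite /doubled_family (unsplitK (inr i)). Qed.

Let map_poly_mderiv_iotaL j (p : {poly mpoly n K}) :
  map_poly (mderiv (lshift n j)) (map_poly iota p) =
  map_poly iota (map_poly (mderiv j) p).
Proof.
by apply/polyP => k; rewrite !coef_map /= mderiv_subst_lshift.
Qed.

Let map_poly_mderiv_iotaR j (p : {poly mpoly n K}) :
  map_poly (mderiv (rshift n j)) (map_poly iota p) = 0.
Proof.
by apply/polyP => k; rewrite !coef_map /= mderiv_subst_rshift coef0.
Qed.

(** The new Jacobian matrix has block rows (J0, 1) and (J', 0), where [J0 + s J'] is the old one. In
    1 minus s times it, the Schur complement of the lower right identity is [1 - s J0 - s^2 J']. *)
Lemma det_doubled_family :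
  \det (1%:M - 'X *: family_jacobian H) = 1 ->
  \det (1%:M - 'X *: family_jacobian doubled_family) = 1.
Proof.
move=> dH.
pose J0 : 'M[{poly mpoly n K}]_n := \matrix_(i, j) (mderiv j (H i)`_0)%:P.
pose J' := family_jacobian (fun i => drop_poly 1 (H i)).
have JE : family_jacobian H = J0 + 'X *: J'.
  apply/matrixP => i j; rewrite !mxE; apply/polyP => -[|k];
    rewrite coefD coefXM coefC coef_map //= ?addr0 ?add0r //.
  by rewrite coef_map coef_drop_poly addn1.
have JtE : family_jacobian doubled_family =
    block_mx (map_mx (map_poly iota) J0) 1%:M
             (map_mx (map_poly iota) J') 0.
  rewrite -[LHS]submxK; congr block_mx; apply/matrixP => i j; rewrite !mxE.
  - rewrite doubled_familyL !map_polyC /= mderivD mderiv_subst_lshift.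
    by rewrite mderivU eq_lrshift addr0.
  - rewrite doubled_familyL !map_polyC /= mderivD mderiv_subst_rshift add0r.
    by rewrite mderivU (inj_eq (@rshift_inj _ _)) eq_sym polyC_natr.
  - by rewrite doubled_familyR map_poly_mderiv_iotaL.
  - by rewrite doubled_familyR map_poly_mderiv_iotaR.
rewrite JtE scale_block_mx scalar_mx_block opp_block_mx add_block_mx.
rewrite scaler0 subr0 !add0r det_block1 mulNmx mulmxN opprK.
rewrite -scalemxAl mul1mx scalerA.
transitivity (\det (map_mx (map_poly iota) (1%:M - 'X *: family_jacobian H))).
  congr (\det _); rewrite JE scalerDr scalerA map_mxB map_mx1 map_mxD !map_mxZ.
  by rewrite opprD addrA /= map_polyX rmorphM /= map_polyX.
by rewrite det_map_mx dH rmorph1.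
Qed.

(** At s = 1 the doubled map sends (x, [tl x]) to (F x, 0), so F is inverted by the first half of
    [G'] at the points (w, 0). *)
Lemma doubled_globally_invertible :
  globally_invertible (fun k => var k - (doubled_family k).[1]) ->
  globally_invertible (fun i => var i - (H i).[1]).
Proof.
pose F' := fun k => var k - (doubled_family k).[1].
pose F := fun i => var i - (H i).[1].
move=> [G' [F'K G'K]].
pose tl (x : 'rV[K]_n) : 'rV[K]_n :=
  \row_i meval (x ord0) (drop_poly 1 (H i)).[1].
have meval_iota (x y : 'rV[K]_n) p :
    meval (row_mx x y ord0) (iota p) = meval (x ord0) p.
  by rewrite meval_subst; apply: meval_eq => i; rewrite mevalXU row_mxEl.
have F'E x y : poly_map F' (row_mx x y) =
    row_mx (poly_map F x + tl x - y) (y - tl x).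
  apply/rowP => k; rewrite -(fintype.splitK k).
  case: (fintype.split k) => i /=; rewrite mxE /F' mevalB mevalXU.
    rewrite [RHS]row_mxEl row_mxEl doubled_familyL hornerC mevalD mevalXU.
    rewrite meval_iota row_mxEr !mxE mevalB mevalXU horner1_drop mevalD.
    by rewrite !opprD !addrA subrK.
  rewrite [RHS]row_mxEr row_mxEr doubled_familyR !mxE; congr (_ - _).
  rewrite -[X in (map_poly _ _).[X]](rmorph1 iota) horner_map.
  exact: meval_iota.
(* [h] embeds w as (w, 0). *)
pose h (k : 'I_(n + n)) : mpoly n K :=
  if fintype.split k is inl i then var i else 0.
pose G i := subst_mpoly h (G' (lshift n i)).
have GE (w : 'rV[K]_n) : poly_map G w = lsubmx (poly_map G' (row_mx w 0)).
  apply/rowP => i; rewrite !mxE meval_subst; apply: meval_eq => k.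
  rewrite -(fintype.splitK k); case: (fintype.split k) => j;
    rewrite /h unsplitK /=.
    by rewrite mevalXU row_mxEl.
  by rewrite meval0 row_mxEr mxE.
exists G; split=> x; rewrite GE.
  have := F'K (row_mx x (tl x)).
  by rewrite -/F' F'E subrr addrK => ->; rewrite row_mxKl.
have := G'K (row_mx x 0); rewrite -/F'; move: (poly_map G' _) => z.
rewrite -[z]hsubmxK F'E row_mxKl => /eq_row_mx [E1 /eqP].
by rewrite subr_eq0 => /eqP E2; rewrite -E1 E2 addrK.
Qed.

End Doubling.

Hypothesis invertible_of_unipotent :
  forall n, (0 < n)%N -> forall H : 'I_n -> mpoly n K,
  \det (1%:M - 'X *: map_mx polyC (jacobian_mx H)) = 1 ->
  globally_invertible (fun i => var i - H i).

(** Each doubling lowers the degree bound in s by one; a family constant in s is covered by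
    [invertible_of_unipotent]. *)
Lemma family_globally_invertible r n (H : 'I_n -> {poly mpoly n K}) :
  (0 < n)%N -> (forall i, (size (H i) <= r.+1)%N) ->
  \det (1%:M - 'X *: family_jacobian H) = 1 ->
  globally_invertible (fun i => var i - (H i).[1]).
Proof.
elim: r n H => [|r IHr] n H n0 sH dH.
  have HE i : H i = ((H i)`_0)%:P by exact: size1_polyC.
  have -> : (fun i => var i - (H i).[1]) = (fun i => var i - (H i)`_0).
    by apply/funext => i; rewrite {1}HE hornerC.
  have JE : map_mx polyC (jacobian_mx (fun i => (H i)`_0)) = family_jacobian H.
    apply/matrixP => i j; rewrite [RHS]mxE [LHS]mxE [X in X%:P = _]mxE.
    by rewrite (map_poly_size1 (mderiv j) (sH i)).
  by apply: (invertible_of_unipotent n0); rewrite JE dH.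
apply: doubled_globally_invertible; apply: IHr.
- by rewrite addn_gt0 n0.
- move=> k; rewrite /doubled_family; case: fintype.split => i.
    by rewrite (leq_trans (size_polyC_leq1 _)).
  by rewrite (leq_trans (size_poly _ _)) // size_drop_poly leq_subLR.
- exact: det_doubled_family.
Qed.

End Linearization.

(** * Dilations and normalization at the origin *)

Section DilatedDerivation.
Context (A B : comNzRingType) (D : {additive A -> A}) (D' : {additive B -> B}).
Context (phi : {rmorphism B -> {poly A}}).
Hypothesis derM : forall x y, D (x * y) = D x * y + x * D y.
Hypothesis derM' : forall x y, D' (x * y) = D' x * y + x * D' y.

(** The chain rule for p(s z), when [phi] is the dilation. *)
Let dilated p := map_poly D (phi p) = 'X * phi (D' p).

Lemma dilatedD p q : dilated p -> dilated q -> dilated (p + q).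
Proof. by rewrite /dilated => Hp Hq; rewrite !raddfD /= Hp Hq mulrDr. Qed.

Lemma dilatedM p q : dilated p -> dilated q -> dilated (p * q).
Proof.
rewrite /dilated => Hp Hq; rewrite derM' rmorphD !rmorphM /=.
by rewrite (map_poly_derM derM) Hp Hq mulrDr !mulrA (mulrC 'X (phi p)).
Qed.

End DilatedDerivation.

Lemma map_polyMXn (A B : nzRingType) (f : {additive A -> B}) (p : {poly A}) k :
  map_poly f (p * 'X^k) = map_poly f p * 'X^k.
Proof.
apply/polyP => l; rewrite coef_map /= !coefMXn coef_map.
by case: ifP => _ //; rewrite raddf0.
Qed.

Section LinearCoefficient.
Context (A B : comNzRingType) (I : finType).
Context (d : I -> {additive B -> B}) (x : I -> A).
Context (phi : {rmorphism B -> {poly A}}) (ev : {rmorphism B -> A}).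
Hypothesis derM : forall i p q, d i (p * q) = d i p * q + p * d i q.
Hypothesis phi0 : forall p, (phi p)`_0 = ev p.

Let linear_part p := (phi p)`_1 = \sum_i ev (d i p) * x i.

Lemma linear_partD p q : linear_part p -> linear_part q -> linear_part (p + q).
Proof.
rewrite /linear_part => Hp Hq; rewrite rmorphD coefD Hp Hq -big_split.
by apply: eq_bigr => i _; rewrite !raddfD mulrDl.
Qed.

Lemma linear_partM p q : linear_part p -> linear_part q -> linear_part (p * q).
Proof.
rewrite /linear_part => Hp Hq; rewrite rmorphM coefM big_ord_recl big_ord1 /=.
rewrite !phi0 Hp Hq mulr_sumr mulr_suml -big_split; apply: eq_bigr => i _ /=.
by rewrite derM rmorphD !rmorphM; ring.
Qed.

End LinearCoefficient.

Section Dilation.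
Context (K : comNzRingType) (n : nat).
Local Notation A := (mpoly n K).

Definition dilation : A -> {poly A} :=
  mmap (polyC \o @mpolyC n K) (fun i => (var i)%:P * 'X).

HB.instance Definition _ := GRing.RMorphism.on dilation.

Lemma dilationX i : dilation (var i) = (var i)%:P * 'X.
Proof. exact: mmapXU. Qed.

Lemma dilationC c : dilation (mpolyC n c) = (mpolyC n c)%:P.
Proof. exact: mmapC. Qed.

Lemma horner_dilation1 p : (dilation p).[1] = p.
Proof.
apply: (mpoly_rmorph_ext (f := horner_eval 1 \o dilation) (g := idfun)).
  by move=> c; rewrite /= /horner_eval dilationC hornerC.
by move=> i; rewrite /= /horner_eval dilationX hornerMX hornerC mulr1.
Qed.

Lemma map_poly_mderiv_dilation j p :
  map_poly (mderiv j) (dilation p) = 'X * dilation (mderiv j p).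
Proof.
have derM := map_poly_derM (D := mderiv j) (@mderivM _ _ j).
elim/mpoly_alg_ind: p => [c|i|p q IHp IHq|p q IHp IHq].
- by rewrite dilationC map_polyC /= !mderivC !rmorph0 mulr0.
- have DX : map_poly (mderiv j) ('X : {poly A}) = 0.
    apply/polyP => k; rewrite coef_map /= coefX raddfMn /= -mpolyC1 mderivC.
    by rewrite mul0rn coef0.
  rewrite dilationX derM DX map_polyC /= !mderivU rmorph_nat.
  by rewrite mulr0 addr0 ?rmorph_nat mulrC.
- exact: dilatedD IHp IHq.
- exact: dilatedM (@mderivM _ _ j) (@mderivM _ _ j) _ _ IHp IHq.
Qed.

Lemma dilation_coef0 p : (dilation p)`_0 = mpolyC n (meval (fun=> 0) p).
Proof.
rewrite -horner_coef0; apply: (mpoly_rmorph_ext (f := horner_eval 0 \o dilation)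
  (g := @mpolyC n K \o meval (fun=> 0))) => [c|i]; rewrite /= /horner_eval.
  by rewrite dilationC hornerC mevalC.
by rewrite dilationX hornerMX mulr0 mevalXU mpolyC0.
Qed.

Lemma dilation_coef1 p : (dilation p)`_1 =
  \sum_j mpolyC n (meval (fun=> 0) (mderiv j p)) * var j.
Proof.
elim/mpoly_alg_ind: p => [c|i|p q IHp IHq|p q IHp IHq].
- by rewrite dilationC coefC big1 // => j _; rewrite mderivC meval0 mpolyC0 mul0r.
- rewrite dilationX coefMX coefC /= (bigD1 i) //= mderivU eqxx meval1 mpolyC1 mul1r.
  rewrite big1 ?addr0 // => j /negbTE ji.
  by rewrite mderivU ji meval0 mpolyC0 mul0r.
- exact: (linear_partD (ev := @mpolyC n K \o meval (fun=> 0)) IHp IHq).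
- exact: (linear_partM (ev := @mpolyC n K \o meval (fun=> 0))
    (@mderivM n K) dilation_coef0 IHp IHq).
Qed.

End Dilation.

Section Normalization.
Context (K : numFieldType).
Hypothesis invertible_of_unipotent :
  forall n, (0 < n)%N -> forall H : 'I_n -> mpoly n K,
  \det (1%:M - 'X *: map_mx polyC (jacobian_mx H)) = 1 ->
  globally_invertible (fun i => var i - H i).

(* Conjugating by the dilation of ratio s turns F = z - H, with H of order at
   least 2, into z - s K(z, s) where s^2 K(z, s) = H(s z). *)
Lemma tangent_id_globally_invertible n (H : 'I_n -> mpoly n K) : (0 < n)%N ->
  (forall i, meval (fun=> 0) (H i) = 0) ->
  (forall i j, meval (fun=> 0) (mderiv j (H i)) = 0) ->
  \det (1%:M - jacobian_mx H) = 1 ->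
  globally_invertible (fun i => var i - H i).
Proof.
move=> n0 H0 dH0 detH.
pose L i := drop_poly 2 (dilation (H i)).
have HL i : dilation (H i) = L i * 'X^2.
  rewrite -[LHS](poly_take_drop 2) -[RHS]add0r; congr (_ + _).
  apply/polyP => -[|[|k]]; rewrite coef_take_poly coef0 //=.
    by rewrite dilation_coef0 H0 mpolyC0.
  by rewrite dilation_coef1 big1 // => j _; rewrite dH0 mpolyC0 mul0r.
have L1 i : (L i).[1] = H i.
  by rewrite -[RHS]horner_dilation1 HL hornerM hornerXn expr1n mulr1.
rewrite -(funext (fun i => congr1 (fun p => var i - p) (L1 i))).
apply: (family_globally_invertible invertible_of_unipotent
  (r := \max_i size (L i))) => //.
  by move=> i; apply: leqW; exact: (@leq_bigmax _ (fun i => size (L i)) i).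
(* Differentiating [H(s z) = s^2 L] gives [s JH(s z) = s^2 JL], and one factor s cancels. *)
have LJ i j : 'X * map_poly (mderiv j) (L i) = dilation (mderiv j (H i)).
  have := map_poly_mderiv_dilation j (H i).
  rewrite HL map_polyMXn expr2 mulrA mulrC => /(mulfI (negbT (polyX_eq0 _))).
  by rewrite mulrC.
have JE : 'X *: family_jacobian L = map_mx (@dilation K n) (jacobian_mx H).
  apply/matrixP => i j; rewrite [RHS]mxE [in RHS]mxE [LHS]mxE [in LHS]mxE.
  exact: LJ.
by rewrite JE -(map_mx1 (@dilation K n)) -map_mxB det_map_mx detH rmorph1.
Qed.

(** Subtracting F(0) and applying the inverse of JF(0) gives [F'], tangent to the identity at 0,
    with Jacobian determinant [c^-1 c = 1]. *)
Lemma jacobian_const_globally_invertible n (F : 'I_n -> mpoly n K) c :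
  (0 < n)%N -> c != 0 -> jacobian_det F = mpolyC n c -> globally_invertible F.
Proof.
move=> n0 c0 detF.
pose M : 'M[K]_n := map_mx (meval (fun=> 0)) (jacobian_mx F).
have detM : \det M = c.
  by rewrite det_map_mx -/(jacobian_det F) detF /= mevalC.
have Mu : M \in unitmx by rewrite unitmxE detM unitfE.
pose P := invmx M.
pose b : 'rV[K]_n := poly_map F 0.
pose F' i : mpoly n K := \sum_k mpolyC n (P i k) * (F k - mpolyC n (b 0 k)).
have dF' i j : mderiv j (F' i) = \sum_k mpolyC n (P i k) * mderiv j (F k).
  rewrite raddf_sum; apply: eq_bigr => k _ /=.
  by rewrite mderivM mderivC mul0r add0r mderivB mderivC subr0.
have [G' [F'K G'K]] : globally_invertible (fun i => var i - (var i - F' i)).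
  apply: tangent_id_globally_invertible => // [i|i j|].
  - rewrite mevalB mevalXU sub0r (raddf_sum (meval (fun=> 0))).
    rewrite big1 ?oppr0 // => k _ /=.
    rewrite mevalM mevalB !mevalC mxE.
    rewrite (@meval_eq _ _ ((0 : 'rV[K]_n) ord0) (fun=> 0)) ?subrr ?mulr0 // => l.
    by rewrite mxE.
  - rewrite mderivB mderivU dF' mevalB (raddf_sum (meval (fun=> 0))) /= rmorph_nat.
    apply/eqP; rewrite subr_eq0; apply/eqP.
    have := congr1 (fun N : 'M[K]_n => N i j) (mulVmx Mu).
    rewrite !mxE eq_sym => <-; apply: eq_bigr => k _.
    by rewrite mevalM mevalC !mxE.
  - have -> : 1%:M - jacobian_mx (fun i => var i - F' i) =
        map_mx (@mpolyC n K) P *m jacobian_mx F.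
      apply/matrixP => i j; rewrite !mxE mderivB mderivU dF' eq_sym opprB.
      by rewrite addrCA subrr addr0; apply: eq_bigr => k _; rewrite !mxE.
    rewrite det_mulmx -/(jacobian_det F) detF det_map_mx det_inv detM.
    by rewrite -mpolyCM mulVf.
have F'E x : poly_map (fun i => var i - (var i - F' i)) x =
    (poly_map F x - b) *m P^T.
  apply/rowP => i; rewrite mxE opprB addrC subrK (raddf_sum (meval (x ord0))) mxE.
  apply: eq_bigr => k _ /=.
  by rewrite mevalM mevalB !mevalC !mxE mulrC.
have PTu : P^T \in unitmx by rewrite unitmx_tr unitmx_inv.
(* [h] is the affine normalization w -> P (w - b), so the inverse of F is [G'] after [h]. *)
pose h k : mpoly n K := \sum_l mpolyC n (P k l) * (var l - mpolyC n (b 0 l)).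
have GE w : poly_map (fun i => subst_mpoly h (G' i)) w =
    poly_map G' ((w - b) *m P^T).
  apply/rowP => i; rewrite !mxE meval_subst; apply: meval_eq => k.
  rewrite (raddf_sum (meval (w ord0))) mxE; apply: eq_bigr => l _ /=.
  by rewrite mevalM mevalB !mevalC mevalXU !mxE mulrC.
exists (fun i => subst_mpoly h (G' i)); split=> x; rewrite GE.
  by rewrite -F'E F'K.
apply: (addIr (- b)); apply: (can_inj (mulmxK PTu)).
by rewrite -F'E G'K.
Qed.

End Normalization.

(** * Gaussian realization of the Abhyankar-Gurjar operators *)

(* With x, y independent standard Gaussian vectors, zeta = x - iy and
   z = (x + iy)/2 satisfy E[zeta_i p] = E[dp/dz_i]: multiplication by zeta
   acts under the expectation as the derivative in z, and E[g(a + z)] = g(a). *)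
Section ComplexGaussian.
Context (K : numFieldType) (im : K) (n : nat).
Hypothesis im2 : im * im = -1.
Local Notation A := (mpoly n K).
Local Notation B := (mpoly (n + n) K).
Variable L : {linear B -> K | *%R}.
Hypothesis L1 : L 1 = 1.
Hypothesis L_ibp : forall k p, L (var k * p) = L (mderiv k p).

Let zeta i : B := var (lshift n i) - im *: var (rshift n i).
Let z i : B := 2^-1 *: (var (lshift n i) + im *: var (rshift n i)).

(** In the coordinates z and zeta this is d/dz_i, and [Dzeta i] is 2 d/dzeta_i. *)
Let Dz i (p : B) := mderiv (lshift n i) p - im *: mderiv (rshift n i) p.
Let Dzeta i (p : B) := mderiv (lshift n i) p + im *: mderiv (rshift n i) p.

Let DzM i p q : Dz i (p * q) = Dz i p * q + p * Dz i q.
Proof. rewrite /Dz !mderivM -!mul_mpolyC; ring. Qed.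

Let DzetaM i p q : Dzeta i (p * q) = Dzeta i p * q + p * Dzeta i q.
Proof. rewrite /Dzeta !mderivM -!mul_mpolyC; ring. Qed.

Let DzD i p q : Dz i (p + q) = Dz i p + Dz i q.
Proof. rewrite /Dz !mderivD -!mul_mpolyC; ring. Qed.

Let DzetaD i p q : Dzeta i (p + q) = Dzeta i p + Dzeta i q.
Proof. rewrite /Dzeta !mderivD -!mul_mpolyC; ring. Qed.

Let DzC i c : Dz i (mpolyC _ c) = 0.
Proof. by rewrite /Dz !mderivC scaler0 subr0. Qed.

Let DzetaC i c : Dzeta i (mpolyC _ c) = 0.
Proof. by rewrite /Dzeta !mderivC scaler0 addr0. Qed.

Let mderivl i j :
  (mderiv (lshift n i) (var (lshift n j)) = (i == j)%:R :> B) *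
  (mderiv (rshift n i) (var (lshift n j)) = 0 :> B) *
  (mderiv (lshift n i) (var (rshift n j)) = 0 :> B) *
  (mderiv (rshift n i) (var (rshift n j)) = (i == j)%:R :> B).
Proof.
by rewrite !mderivU (inj_eq (@lshift_inj _ _)) (inj_eq (@rshift_inj _ _))
  eq_lrshift eq_rlshift.
Qed.

Let Dz_zeta i j : Dz i (zeta j) = 0.
Proof.
rewrite /Dz /zeta !mderivB !mderivZ !mderivl scaler0 subr0 sub0r.
by rewrite scalerN scalerA im2 scaleN1r opprK subrr.
Qed.

Let Dz_z i j : Dz i (z j) = (i == j)%:R.
Proof.
rewrite /Dz /z !mderivZ !mderivD !mderivZ !mderivl scaler0 addr0 add0r.
rewrite (scalerA 2^-1) scalerA mulrCA im2 mulrN1 scaleNr opprK -scalerDl.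
by have -> : 2^-1 + 2^-1 = 1 :> K; [field | rewrite scale1r].
Qed.

Let Dzeta_z i j : Dzeta i (z j) = 0.
Proof.
rewrite /Dzeta /z !mderivZ !mderivD !mderivZ !mderivl scaler0 addr0 add0r.
by rewrite (scalerA 2^-1) scalerA mulrCA im2 mulrN1 scaleNr subrr.
Qed.

Let L_zeta i p : L (zeta i * p) = L (Dz i p).
Proof. by rewrite mulrBl -scalerAl !linearB !linearZ /= !L_ibp. Qed.

Let L_z i p : L (z i * p) = 2^-1 * L (Dzeta i p).
Proof.
by rewrite -scalerAl mulrDl -scalerAl linearZ !linearD !linearZ /= !L_ibp.
Qed.

Variable a : 'I_n -> K.

Let iota : {rmorphism A -> B} := subst_mpoly (fun i => mpolyC _ (a i) + z i).

Let iotaC c : iota (mpolyC n c) = mpolyC _ c.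
Proof. exact: subst_mpolyC. Qed.

Let iotaX i : iota (var i) = mpolyC _ (a i) + z i.
Proof. exact: subst_mpolyX. Qed.

Let Dz_iota i g : Dz i (iota g) = iota (mderiv i g).
Proof.
elim/mpoly_alg_ind: g => [c|j|p q IHp IHq|p q IHp IHq].
- by rewrite iotaC DzC mderivC rmorph0.
- by rewrite iotaX DzD DzC add0r Dz_z mderivU rmorph_nat.
- by rewrite (rmorphD iota) DzD IHp IHq mderivD (rmorphD iota).
- by rewrite (rmorphM iota) DzM IHp IHq mderivM (rmorphD iota) !(rmorphM iota).
Qed.

Let Dzeta_iota i g : Dzeta i (iota g) = 0.
Proof.
elim/mpoly_alg_ind: g => [c|j|p q IHp IHq|p q IHp IHq].
- by rewrite iotaC DzetaC.
- by rewrite iotaX DzetaD DzetaC add0r Dzeta_z.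
- by rewrite (rmorphD iota) DzetaD IHp IHq addr0.
- by rewrite (rmorphM iota) DzetaM IHp IHq mul0r mulr0 addr0.
Qed.

(** The mean value property: [iota g] is holomorphic, that is, killed by [Dzeta], so by [L_z] every
    factor z_i contributes 0. *)
Let L_iota g : L (iota g) = meval a g.
Proof.
suff Lmul p q : L (iota p * iota q) = meval a p * L (iota q).
  by rewrite -[iota g]mulr1 -(rmorph1 iota) Lmul rmorph1 L1 mulr1.
elim/mpoly_alg_ind: p q => [c|j|p p' IHp IHp'|p p' IHp IHp'] q.
- by rewrite iotaC mevalC mul_mpolyC linearZ.
- by rewrite iotaX mevalXU mulrDl linearD /= mul_mpolyC linearZ L_z Dzeta_iota
    linear0 mulr0 addr0.
- by rewrite (rmorphD iota) mulrDl linearD /= IHp IHp' mevalD mulrDl.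
- by rewrite (rmorphM iota) -mulrA -(rmorphM iota) IHp (rmorphM iota) IHp'
    mevalM mulrA.
Qed.

Let mderivs (w : seq 'I_n) (g : A) := foldl (fun g i => mderiv i g) g w.

(** Integration by parts, one zeta at a time: [Dz i] kills the remaining zetas and falls on
    [iota g]. *)
Let L_monomial w g : L ((\prod_(i <- w) zeta i) * iota g) = meval a (mderivs w g).
Proof.
elim: w g => [|i w IHw] g; first by rewrite big_nil mul1r L_iota.
rewrite big_cons -mulrA L_zeta DzM Dz_iota -[RHS]IHw.
have -> : Dz i (\prod_(j <- w) zeta j) = 0.
  elim/big_rec: _ => [|j p _ IHp]; first by rewrite -mpolyC1 DzC.
  by rewrite DzM Dz_zeta IHp mul0r mulr0 addr0.
by rewrite mul0r add0r.
Qed.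

Let mderivs_sum w (f : 'I_n -> A) :
  mderivs w (\sum_i f i) = \sum_i mderivs w (f i).
Proof. by elim: w f => //= i w IHw f; rewrite raddf_sum IHw. Qed.

Variable H : 'I_n -> A.

(** Here [p] is the sum of the zeta_i H_i(a + z) and [f g] is g(a + z); each zeta_i becomes a
    derivative. The clause [f 1 = 1] makes the moments of [p] the case [g = 1]. *)
Lemma gaussian_ag : exists (p : B) (f : A -> B), f 1 = 1 /\
  forall m g, L (p ^+ m * f g) = meval a (ag H m g).
Proof.
exists (\sum_i zeta i * iota (H i)), iota; split=> [|m g]; first exact: rmorph1.
(* The word [w] records the zetas already split off from factors of [p]. *)
have claim w : L ((\prod_(i <- w) zeta i) *
    ((\sum_i zeta i * iota (H i)) ^+ m * iota g)) =
    meval a (mderivs w (ag H m g)); last first.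
  by have := claim [::]; rewrite big_nil mul1r.
elim: m g w => [|m IHm] g w; first by rewrite expr0 mul1r L_monomial.
rewrite exprS -mulrA mulr_suml mulr_sumr linear_sum /= mderivs_sum.
rewrite (raddf_sum (meval a)); apply: eq_bigr => i _ /=.
rewrite -[RHS](IHm (H i * g) (i :: w)) big_cons (rmorphM iota).
by congr (L _); ring.
Qed.

End ComplexGaussian.

(** * Moments of the standard normal law *)

Section NormalDensity.
Context (R : realType).
Local Notation mu := (@lebesgue_measure R).
Local Notation N := (@normal_prob R 0 1).
Local Notation phi := (@normal_pdf R 0 1).
Local Open Scope ereal_scope.

(** The density agrees almost everywhere with the Radon-Nikodym derivative, as both have the same
    integrals over measurable sets. *)
Lemma ge0_integral_normal_prob (f : R -> \bar R) :
  measurable_fun setT f -> (forall x, 0 <= f x) ->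
  \int[N]_x f x = \int[mu]_x (f x * (phi x)%:E).
Proof.
move=> mf f0.
have dom : N `<< mu := @normal_prob_dominates R 0 1.
rewrite -(Radon_Nikodym_SigmaFinite.change_of_variables dom f0 measurableT mf).
have mRN := measurable_int _ (Radon_Nikodym_SigmaFinite.f_integrable dom).
apply: ge0_ae_eq_integral => //.
- by apply: emeasurable_funM.
- apply: emeasurable_funM => //; apply/measurable_EFinP.
  exact: measurable_normal_pdf.
- by move=> x _; rewrite mule_ge0 //; exact: Radon_Nikodym_SigmaFinite.f_ge0.
- by move=> x _; rewrite mule_ge0 // lee_fin normal_pdf_ge0.
apply: ae_eqe_mul2l; apply: integral_ae_eq => //.
- exact: Radon_Nikodym_SigmaFinite.f_integrable.
- by apply/measurable_EFinP; exact: measurable_normal_pdf.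
- by move=> A _ mA; rewrite -Radon_Nikodym_SigmaFinite.f_integral.
Qed.

Lemma integral_normal_prob (f : R -> R) :
  measurable_fun setT f ->
  \int[N]_x (f x)%:E = \int[mu]_x (f x * phi x)%:E.
Proof.
move=> mf; rewrite [LHS]integralE [RHS]integralE.
have mfE : measurable_fun setT (EFin \o f) by exact/measurable_EFinP.
congr (_ - _); rewrite ge0_integral_normal_prob //.
- apply: eq_integral => x _.
  by rewrite !funeposE muleC maxe_pMr ?lee_fin ?normal_pdf_ge0 // mule0 muleC EFinM.
- exact: measurable_funepos.
- apply: eq_integral => x _.
  rewrite !funenegE muleC maxe_pMr ?lee_fin ?normal_pdf_ge0 //.
  by rewrite mule0 muleN muleC EFinM.
- exact: measurable_funeneg.
Qed.

Lemma integrable_normal_prob (f : R -> R) : measurable_fun setT f ->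
  mu.-integrable setT (fun x => (f x * phi x)%:E) ->
  N.-integrable setT (EFin \o f).
Proof.
move=> mf /integrableP [_ fphi]; apply/integrableP; split.
  exact/measurable_EFinP.
rewrite ge0_integral_normal_prob //.
  apply: le_lt_trans fphi; rewrite le_eqVlt; apply/orP; left; apply/eqP.
  apply: eq_integral => x _.
  by rewrite /= normrM (ger0_norm (normal_pdf_ge0 _ _ _)).
by apply: measurableT_comp => //; exact/measurable_EFinP.
Qed.

End NormalDensity.

Section GaussianMoments.
Context (R : realType).
Local Notation mu := (@lebesgue_measure R).
Local Notation N := (@normal_prob R 0 1).
Local Notation phi := (@normal_pdf R 0 1).
Let peak : R := @normal_peak R 1.

Lemma standard_normal_pdfE x : phi x = peak * expR (- x ^+ 2 / 2).
Proof.
by rewrite normal_pdfE ?oner_neq0 // /normal_fun subr0 expr1n.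
Qed.

(** Half of the exponent absorbs the power: with [t = x^2 / 4], [t^(k+1)] is at most
    [(k+1)! exp t]. *)
Lemma pow_expR_bound k : exists2 D : R, 0 <= D &
  forall x : R, `|x| ^+ k * expR (- x ^+ 2 / 2) <= D * expR (- x ^+ 2 / 4).
Proof.
(* The summand 1 serves [|x| <= 1]; beyond, [|x|^k] is at most [|x|^(2(k+1)) = (4 t)^(k+1)]. *)
exists (1 + 4 ^+ k.+1 * (k.+1)`!%:R) => [|x].
  by rewrite addr_ge0 // mulr_ge0 // exprn_ge0.
pose t := x ^+ 2 / 4.
have t0 : 0 <= t by rewrite divr_ge0 // sqr_ge0.
have -> : - x ^+ 2 / 2 = - t + - t by rewrite /t; field.
have -> : - x ^+ 2 / 4 = - t by rewrite /t mulNr.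
rewrite expRD mulrA ler_wpM2r ?expR_ge0 // expRN ler_pdivrMr ?expR_gt0 //.
have et1 : 1 <= expR t by rewrite -[leLHS]expR0 ler_expR.
have et : t ^+ k.+1 <= (k.+1)`!%:R * expR t.
  rewrite mulrC -ler_pdivrMr ?ltr0n ?fact_gt0 //.
  by rewrite (le_trans _ (expR_ge1Dxn k t0)) // lerDr.
have xE : `|x| ^+ 2 = 4 * t by rewrite /t real_normK ?num_real //; field.
rewrite mulrDl mul1r; have [x1|x1] := leP `|x| 1.
  rewrite (le_trans (exprn_ile1 _ _ x1)) // (le_trans et1) // lerDl.
  by rewrite mulr_ge0 ?expR_ge0 // mulr_ge0 // exprn_ge0.
rewrite (@le_trans _ _ (`|x| ^+ (2 * k.+1))) //.
  by rewrite ler_weXn2l ?(ltW x1) // (leq_trans (leqnSn k)) // leq_pmull.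
rewrite exprM xE exprMn -mulrA ler_wpDl ?expR_ge0 // ler_wpM2l // exprn_ge0 //.
Qed.

Lemma integrable_pow_normal_pdf k :
  mu.-integrable setT (fun x => (x ^+ k * phi x)%:E).
Proof.
have [D D0 HD] := pow_expR_bound k.
have s20 : Num.sqrt 2 != 0 :> R by rewrite gt_eqF // sqrtr_gt0.
(* [C] rescales the normal density of variance 2, proportional to [exp (- x^2 / 4)], into the
   dominating function. *)
pose C := peak * D / normal_peak (Num.sqrt 2).
have := integrableZl measurableT C (integrable_normal_pdf 0 (Num.sqrt 2)).
apply: le_integrable => //.
  apply/measurable_EFinP; apply: measurable_funM => //.
  exact: measurable_normal_pdf.
move=> x _; rewrite /= lee_fin.
rewrite normrM normrX (ger0_norm (normal_pdf_ge0 _ _ _)) standard_normal_pdfE.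
rewrite (le_trans _ (ler_norm _)) // normal_pdfE // /normal_fun subr0 sqr_sqrtr //.
have np0 : normal_peak (Num.sqrt 2) != 0 :> R by rewrite gt_eqF // normal_peak_gt0.
rewrite (_ : C * _ = peak * (D * expR (- x ^+ 2 / 4))); last first.
  rewrite (_ : 2 *+ 2 = 4) ?/C; last by rewrite -mulr_natr -natrM.
  by field.
by rewrite mulrCA ler_wpM2l ?normal_peak_ge0.
Qed.

Lemma is_derive_pow_normal_pdf k (x : R) :
  is_derive x 1 (fun x => x ^+ k * phi x)
    (k%:R * x ^+ k.-1 * phi x - x ^+ k.+1 * phi x).
Proof.
have phiE : phi = (fun x => peak * expR (- x ^+ 2 / 2)).
  by apply/funext => y; rewrite standard_normal_pdfE.
rewrite phiE.
have dexp : is_derive x 1 (fun x : R => expR (- x ^+ 2 / 2))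
    (- x * expR (- x ^+ 2 / 2)).
  have dq : is_derive x 1 (fun x : R => - x ^+ 2 / 2) (- x).
    by apply: is_derive_eq; rewrite /GRing.scale /=; field.
  have := @is_derive1_comp _ expR (fun x => - x ^+ 2 / 2) x _ _
    (is_derive_expR _) dq.
  by move/is_derive_eq; apply; rewrite mulrC.
have dp : is_derive x 1 (fun x : R => peak * expR (- x ^+ 2 / 2))
    (peak * (- x * expR (- x ^+ 2 / 2))).
  by apply: is_deriveZ dexp.
have dX : is_derive x 1 (fun x : R => x ^+ k) (k%:R * x ^+ k.-1).
  rewrite (_ : (fun x : R => x ^+ k) = (id : R -> R) ^+ k).
    apply: is_derive_eq (is_deriveX k (is_derive_id x 1)) _.
    by rewrite /GRing.scale /= mulr1.
  by apply/funext => y; rewrite exprfctE.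
have := is_deriveM dX dp.
move/is_derive_eq; apply; rewrite /GRing.scale /= (exprSr x k).
by set e := expR _; ring.
Qed.

Lemma continuous_pow_normal_pdf k : continuous (fun x : R => x ^+ k * phi x).
Proof.
move=> x; apply: differentiable_continuous; apply/derivable1_diffP.
by have := is_derive_pow_normal_pdf k x => -[].
Qed.

Let dF k (x : R) := k%:R * x ^+ k.-1 * phi x - x ^+ k.+1 * phi x.

Let continuous_dF k : continuous (dF k).
Proof.
move=> x; rewrite /dF.
under eq_fun do rewrite -mulrA.
apply: cvgB; last exact: continuous_pow_normal_pdf.
by apply: cvgM; [exact: cvg_cst|exact: continuous_pow_normal_pdf].
Qed.

Let integrable_dF k : mu.-integrable setT (EFin \o dF k).
Proof.
have -> : EFin \o dF k = (fun x => (k%:R)%:E * (x ^+ k.-1 * phi x)%:E -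
    (x ^+ k.+1 * phi x)%:E)%E.
  by apply/funext => x; rewrite /= /dF -mulrA.
apply: integrableB => //; last exact: integrable_pow_normal_pdf.
by apply: integrableZl => //; exact: integrable_pow_normal_pdf.
Qed.

Let F k (x : R) := x ^+ k * phi x.

Let integral_dF_itv k (n : nat) (r := n.+1%:R : R) :
  (\int[mu]_(x in `[(- r)%R, r]) (dF k x)%:E = (F k r - F k (- r))%:E)%E.
Proof.
have F' (x : R) : is_derive x 1 (F k) (dF k x).
  exact: is_derive_pow_normal_pdf.
rewrite (@continuous_FTC2 _ _ (F k)).
- by rewrite EFinB.
- by rewrite gtrN.
- exact/continuous_subspaceT/continuous_dF.
- split.
  + by move=> x _; have [] := F' x.
  + exact/cvg_at_right_filter/continuous_pow_normal_pdf.
  + exact/cvg_at_left_filter/continuous_pow_normal_pdf.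
- by move=> x _; rewrite derive1E; have [] := F' x.
Qed.

Local Open Scope classical_set_scope.

Let F_bound k : exists M : R, forall x, `|x| ^+ k * phi x <= M.
Proof.
have [D D0 HD] := pow_expR_bound k; exists (peak * D) => x.
rewrite standard_normal_pdfE mulrCA ler_wpM2l ?normal_peak_ge0 //.
rewrite (le_trans (HD x)) // ler_piMr // -[leRHS]expR0 ler_expR.
by rewrite mulNr oppr_le0 divr_ge0 // sqr_ge0.
Qed.

Let cvg_F k : F k n.+1%:R - F k (- n.+1%:R) @[n --> \oo] --> (0 : R).
Proof.
(* The bound with one more power of |x| yields decay in 1/|x|. *)
have [M HM] := F_bound k.+1.
have FM (n : nat) (x : R) : `|x| = n.+1%:R -> `|F k x| <= M / n.+1%:R.
  move=> xn; rewrite ler_pdivlMr ?ltr0n // -xn.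
  rewrite normrM normrX (ger0_norm (normal_pdf_ge0 _ _ _)) mulrAC -exprSr.
  exact: HM.
apply/norm_cvg0P.
apply: (@squeeze_cvgr _ _ _ _ (fun=> 0) (fun n => 2 * M * n.+1%:R^-1)).
- apply: nearW => n; rewrite normr_ge0 /= (le_trans (ler_normB _ _)) //.
  have -> : 2 * M * n.+1%:R^-1 = M / n.+1%:R + M / n.+1%:R by ring.
  by rewrite lerD // FM // ?normrN ger0_norm.
- exact: cvg_cst.
- rewrite -(mulr0 (2 * M)); apply: cvgM; first exact: cvg_cst.
  exact: cvg_harmonic.
Qed.

(** On the intervals [-(n+1), n+1] the integral is a boundary term tending to 0; dominated
    convergence, with bound |dF|, passes to the whole line. *)
Let integral_dF k : (\int[mu]_x (dF k x)%:E)%E = 0%E.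
Proof.
pose f_ n : R -> \bar R :=
  (EFin \o dF k) \_ `[(- (n.+1%:R : R)), n.+1%:R].
have mdF : measurable_fun setT (EFin \o dF k).
  by have /integrableP[] := integrable_dF k.
have f_cvg x : f_ ^~ x @ \oo --> (dF k x)%:E.
  apply: cvg_near_cst.
  near=> n; rewrite /f_ patchE ifT // inE /= in_itv /= -ler_norml.
  near: n; exists (Num.bound `|x|) => // m /= xm.
  rewrite (le_trans (ltW (archi_boundP (normr_ge0 x)))) // ler_nat.
  exact: leq_trans xm (leqnSn m).
have [] := @dominated_convergence _ _ _ mu setT measurableT f_ (EFin \o dF k)
  (abse \o (EFin \o dF k)).
- move=> n; apply: (measurable_restrictT _ (measurable_itv _)).1.
  exact: measurable_funTS.
- exact: mdF.
- exact: aeW.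
- by apply: integrable_abse; exact: integrable_dF.
- apply: aeW => x n _; rewrite /f_ patchE; case: ifP => // _.
  by rewrite abse0 abse_ge0.
move=> _ _ cvgI.
apply/esym; apply: (cvg_unique _ _ cvgI) => //.
rewrite (_ : (fun n => _) = EFin \o (fun n => F k n.+1%:R - F k (- n.+1%:R))).
  by apply: cvg_EFin; [exact: nearW|exact: cvg_F].
by apply/funext => n; rewrite /= -integral_dF_itv [RHS]integral_mkcond.
Unshelve. all: by end_near. Qed.

Definition gaussian_moment k : R := fine (\int[N]_x (x ^+ k)%:E)%E.

Lemma integrable_pow_normal_prob k :
  N.-integrable setT (fun x => (x ^+ k)%:E).
Proof.
apply: integrable_normal_prob => //.
exact: integrable_pow_normal_pdf.
Qed.

Lemma integral_pow_normal_prob k :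
  (\int[N]_x (x ^+ k)%:E = (gaussian_moment k)%:E)%E.
Proof. by rewrite fineK // integrable_fin_num // integrable_pow_normal_prob. Qed.

Lemma gaussian_moment0 : gaussian_moment 0 = 1.
Proof.
rewrite /gaussian_moment (eq_integral (cst 1%E)) => [|x _]; last by rewrite expr0.
rewrite integral_cst // mul1e.
exact: (congr1 fine (@probability_setT _ _ _ N)).
Qed.

(** Integration by parts, in the form [integral_dF]. At [k = 0] the coefficient 0 kills the term
    with the truncated predecessor. *)
Lemma gaussian_momentS k :
  gaussian_moment k.+1 = k%:R * gaussian_moment k.-1.
Proof.
have pdfE l : (\int[mu]_x (x ^+ l * phi x)%:E = (gaussian_moment l)%:E)%E.
  by rewrite -integral_normal_prob // integral_pow_normal_prob.
have := integral_dF k.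
under eq_integral => x _ do rewrite /dF -mulrA EFinB EFinM.
rewrite integralB //; first last.
- exact: integrable_pow_normal_pdf.
- by apply: integrableZl => //; exact: integrable_pow_normal_pdf.
rewrite integralZl //; last exact: integrable_pow_normal_pdf.
rewrite !pdfE -EFinM -EFinB => -[] /eqP; rewrite subr_eq0 => /eqP ->.
by [].
Qed.

End GaussianMoments.

(** * Construction of independent standard normal variables *)

Section ProductIntegral.
Context d1 d2 (T1 : measurableType d1) (T2 : measurableType d2) (R : realType).
Variables (P1 : probability T1 R) (P2 : probability T2 R).
Variables (f : T1 -> R) (g : T2 -> R).
Hypothesis intf : P1.-integrable setT (EFin \o f).
Hypothesis intg : P2.-integrable setT (EFin \o g).
Local Open Scope ereal_scope.

Lemma integrable_prod_mul :
  (P1 \x P2).-integrable setT (fun w : T1 * T2 => (f w.1 * g w.2)%:E).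
Proof.
have /integrableP [mf foo] := intf; have /integrableP [mg goo] := intg.
have mabs d (T : measurableType d) (h : T -> R) :
    measurable_fun setT (EFin \o h) ->
    measurable_fun setT (fun x => (`|h x|)%:E).
  move=> mh; apply/measurable_EFinP.
  by apply: measurableT_comp => //; exact/measurable_EFinP.
apply/integrable12ltyP.
  apply/measurable_EFinP; apply: measurable_funM.
    by apply: measurableT_comp; [exact/measurable_EFinP|exact: measurable_fst].
  by apply: measurableT_comp; [exact/measurable_EFinP|exact: measurable_snd].
under eq_integral => x _.
  under eq_integral => y _ do rewrite /= normrM EFinM.
  rewrite ge0_integralZl //; last exact: mabs.
  over.
rewrite /= ge0_integralZr //.
- by rewrite lte_mul_pinfty // ?integral_ge0 // ge0_fin_numE ?integral_ge0.
- exact: mabs.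
- exact: integral_ge0.
Qed.

Lemma integral_prod_mul :
  \int[P1 \x P2]_w (f w.1 * g w.2)%:E =
  (\int[P1]_x (f x)%:E) * (\int[P2]_y (g y)%:E).
Proof.
rewrite -(integral12_prod_meas1 integrable_prod_mul) /fubini_F /=.
under eq_integral => x _.
  under eq_integral => y _ do rewrite EFinM.
  rewrite integralZl //.
  over.
have /fineK <- := integrable_fin_num measurableT intg.
by rewrite integralZr.
Qed.

End ProductIntegral.

Section GaussianSpace.
Context (R : realType).

Definition rv_of d (T : measurableType d) (P : probability T R) (f : T -> R)
    (mf : measurable_fun setT f) : {RV P >-> R} :=
  HB.pack_for {mfun T >-> R} f (isMeasurableFun.Build _ _ _ _ f mf).

Local Open Scope classical_set_scope.

(** By induction, starting from a one-point space and taking the product with one more normal law;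
    Fubini factors the mixed moments. *)
Lemma gaussian_space n : exists (d : measure_display) (T : measurableType d)
    (P : probability T R) (X : 'I_n -> {RV P >-> R}),
  [/\ forall i, standard_normal (X i), mutually_independent X,
   forall e : 'I_n -> nat,
     P.-integrable setT (fun w => (\prod_i X i w ^+ e i)%:E) &
   forall e : 'I_n -> nat, (\int[P]_w (\prod_i X i w ^+ e i)%:E)%E =
     (\prod_i gaussian_moment R (e i))%:E].
Proof.
elim: n => [|n [d [T [P [X [Xnormal Xindep Xint Xmom]]]]]].
  exists _, unit, (dirac tt : probability unit R).
  exists (fun=> rv_of _ (measurable_cst (0 : R))).
  split=> [[]//|J A mA|e|e].
  - rewrite big1 => [|[]//].
    rewrite (_ : \bigcap_(i in _) _ = setT) ?probability_setT //.
    by apply/seteqP; split=> // x _ [].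
  - rewrite [X in _.-integrable _ X](_ : _ = cst 1%:E).
      exact: finite_measure_integrable_cst.
    by apply/funext => w; rewrite big1 // => -[].
  - rewrite (eq_integral (cst 1%:E)) => [|w _]; last by rewrite big1 // => -[].
    rewrite integral_cst // mul1e big1 => [|[] //].
    exact: (@probability_setT _ _ _ (dirac tt : probability unit R)).
pose N : probability (measurableTypeR R) R := @normal_prob R 0 1.
pose P' : probability (T * measurableTypeR R)%type R := (P \x N)%E.
have mfst (j : 'I_n) : measurable_fun setT
    ((X j \o fst) : T * measurableTypeR R -> R).
  by apply: measurableT_comp => //; exact: measurable_fst.
have msnd : measurable_fun setT (snd : T * measurableTypeR R -> R).
  exact: measurable_snd.
pose X' (i : 'I_n.+1) : {RV P' >-> R} :=
  if unlift ord0 i is Some j then rv_of P' (mfst j) else rv_of P' msnd.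
have X'0 w : X' ord0 w = w.2 by rewrite /X' unlift_none.
have X'S j w : X' (lift ord0 j) w = X j w.1 by rewrite /X' liftK.
have P'E A B : measurable A -> measurable B -> P' (A `*` B) = (P A * N B)%E.
  exact: product_measure1E.
have X'mom (e : 'I_n.+1 -> nat) w : \prod_i X' i w ^+ e i =
    (\prod_j X j w.1 ^+ e (lift ord0 j)) * w.2 ^+ e ord0.
  rewrite big_ord_recl X'0 mulrC; congr (_ * _).
  by apply: eq_bigr => j _; rewrite X'S.
have mpreim j A : measurable A -> measurable (X j @^-1` A).
  by move=> mA; rewrite -[_ @^-1` _]setTI; exact: measurable_funP.
have P'0 A : measurable A -> P' (X' ord0 @^-1` A) = N A.
  move=> mA; rewrite (_ : _ @^-1` _ = setT `*` A).
    by rewrite P'E // probability_setT mul1e.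
  by apply/seteqP; split=> w /=; rewrite X'0 //; case.
have P'S j A : measurable A -> P' (X' (lift ord0 j) @^-1` A) = P (X j @^-1` A).
  move=> mA; rewrite (_ : _ @^-1` _ = (X j @^-1` A) `*` setT).
    by rewrite P'E ?probability_setT ?mule1 //; exact: mpreim.
  by apply/seteqP; split=> w /=; rewrite X'S //; case.
exists _, _, P', X'; split.
- move=> i A mA; rewrite /distribution /pushforward.
  by have [j ->|->] := unliftP ord0 i; [rewrite P'S //; exact: Xnormal|exact: P'0].
- move=> J A mA.
  (* The event becomes a rectangle: [J'] indexes the conditions on the old variables, and [A0] is
     the condition on the new one, [setT] if there is none. *)
  pose J' := [set j | lift ord0 j \in J]%SET.
  pose A0 := if ord0 \in J then A ord0 else setT.
  have mA0 : measurable A0 by rewrite /A0; case: ifP.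
  rewrite (_ : \bigcap_(i in _) _ =
    (\bigcap_(j in [set` J']) (X j @^-1` A (lift ord0 j))) `*` A0); last first.
    apply/seteqP; split=> w /=.
      move=> Aw; split.
        by move=> j /=; rewrite inE => /Aw /=; rewrite X'S.
      by rewrite /A0; case: ifP => // /Aw /=; rewrite X'0.
    move=> [AS A0w] i /= iJ; have [j ij|i0] := unliftP ord0 i.
      by rewrite ij X'S; apply: AS; rewrite /= inE -ij.
    by move: A0w; rewrite i0 X'0 /A0 -i0 iJ.
  rewrite P'E //; last first.
    apply: fin_bigcap_measurable => // j _; exact: mpreim.
  rewrite (Xindep J' (fun j => A (lift ord0 j))) // muleC.
  rewrite [in RHS]big_mkcond big_ord_recl; congr (_ * _)%E.
    rewrite /A0; case: ifP => _; first by rewrite P'0.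
    exact: (@probability_setT _ _ _ N).
  rewrite big_mkcond; apply: eq_bigr => j _.
  by rewrite inE; case: ifP => // _; rewrite P'S.
- move=> e.
  rewrite (_ : (fun w => _) = (fun w => ((\prod_j X j w.1 ^+ e (lift ord0 j)) *
    w.2 ^+ e ord0)%:E)); last by apply/funext => w; rewrite X'mom.
  apply: (integrable_prod_mul (f := fun x => \prod_j X j x ^+ e (lift ord0 j))
    (g := fun y : measurableTypeR R => y ^+ e ord0)).
    exact: Xint.
  exact: integrable_pow_normal_prob.
- move=> e.
  under eq_integral => w _ do rewrite X'mom.
  rewrite (integral_prod_mul (f := fun x => \prod_j X j x ^+ e (lift ord0 j))
    (g := fun y : measurableTypeR R => y ^+ e ord0)).
  + rewrite Xmom integral_pow_normal_prob -EFinM big_ord_recl mulrC.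
    by [].
  + exact: Xint.
  + exact: integrable_pow_normal_prob.
Qed.

End GaussianSpace.

(** * Expectation as a linear functional on polynomials *)

Section ComplexExpectation.
Context (d : measure_display) (T : measurableType d) (R : realType).
Variable P : probability T R.

Definition complex_integrable (Y : T -> R[i]) : Prop :=
  P.-integrable setT (EFin \o (fun w => complex.Re (Y w))) /\
  P.-integrable setT (EFin \o (fun w => complex.Im (Y w))).

Lemma complex_expectationE Y : complex_expectation P Y =
  ((\int[P]_w complex.Re (Y w)) +i* (\int[P]_w complex.Im (Y w)))%C.
Proof. by rewrite /complex_expectation unlock. Qed.

Let integrable_lin3 (u v : R) (f g h : T -> R) :
  P.-integrable setT (EFin \o f) -> P.-integrable setT (EFin \o g) ->
  P.-integrable setT (EFin \o h) ->
  P.-integrable setT (EFin \o (fun w => u * f w + v * g w + h w)).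
Proof.
move=> intf intg inth.
rewrite (_ : _ \o _ = (fun w => u%:E * (f w)%:E + v%:E * (g w)%:E + (h w)%:E)%E) //.
by apply: integrableD => //; apply: integrableD => //; exact: integrableZl.
Qed.

Let Rintegral_lin3 (u v : R) (f g h : T -> R) :
  P.-integrable setT (EFin \o f) -> P.-integrable setT (EFin \o g) ->
  P.-integrable setT (EFin \o h) ->
  \int[P]_w (u * f w + v * g w + h w) =
  u * (\int[P]_w f w) + v * (\int[P]_w g w) + \int[P]_w h w.
Proof.
move=> intf intg inth.
have intZ (c : R) k : P.-integrable setT (EFin \o k) ->
    P.-integrable setT (EFin \o (fun w => c * k w)) by exact: integrableZl.
rewrite RintegralD //; last first.
  rewrite (_ : _ \o _ = (fun w => u%:E * (f w)%:E + v%:E * (g w)%:E)%E) //.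
  by apply: integrableD => //; exact: intZ.
by rewrite RintegralD ?RintegralZl //; exact: intZ.
Qed.

Lemma complex_integrable_lin c Y Z : complex_integrable Y ->
  complex_integrable Z -> complex_integrable (fun w => c * Y w + Z w).
Proof.
case: c => a b [intRY intIY] [intRZ intIZ]; split.
  have := integrable_lin3 a (- b) intRY intIY intRZ.
  congr (_.-integrable _ _); apply/funext => w /=.
  by case: (Y w) (Z w) => [y y'] [z z'] /=; rewrite mulNr.
have := integrable_lin3 a b intIY intRY intIZ.
congr (_.-integrable _ _); apply/funext => w /=.
by case: (Y w) (Z w) => [y y'] [z z'].
Qed.

Lemma complex_expectation_lin c Y Z : complex_integrable Y ->
  complex_integrable Z ->
  complex_expectation P (fun w => c * Y w + Z w) =
  c * complex_expectation P Y + complex_expectation P Z.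
Proof.
case: c => a b [intRY intIY] [intRZ intIZ]; rewrite !complex_expectationE.
apply/eqP; rewrite eq_complex /=; apply/andP; split; apply/eqP.
  rewrite -mulNr -Rintegral_lin3 //; congr fine; apply: eq_integral => w _.
  by case: (Y w) (Z w) => [y y'] [z z'] /=; rewrite mulNr.
rewrite -Rintegral_lin3 //; congr fine; apply: eq_integral => w _.
by case: (Y w) (Z w) => [y y'] [z z'].
Qed.

End ComplexExpectation.

Section GaussianFunctional.
Context (R : realType) (d : measure_display) (T : measurableType d).
Context (P : probability T R) (n : nat) (X : 'I_n -> {RV P >-> R}).
Local Notation B := (mpoly n R[i]).
Hypothesis integrable_monomial : forall e : 'I_n -> nat,
  P.-integrable setT (fun w => (\prod_i X i w ^+ e i)%:E).
Hypothesis integral_monomial : forall e : 'I_n -> nat,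
  (\int[P]_w (\prod_i X i w ^+ e i)%:E)%E =
  (\prod_i gaussian_moment R (e i))%:E.

Let poly_rvX (m : multinom n) w :
  poly_rv X (mpolyX _ m) w = ((\prod_i X i w ^+ m i)%:C)%C.
Proof.
rewrite /poly_rv mevalX rmorph_prod; apply: eq_bigr => i _.
by rewrite rmorphXn.
Qed.

Let poly_rv_lin c p q :
  poly_rv X (c *: p + q) = (fun w => c * poly_rv X p w + poly_rv X q w).
Proof. by apply/funext => w; rewrite /poly_rv mevalD mevalZ. Qed.

Let integrable_poly_rvX m : complex_integrable P (poly_rv X (mpolyX _ m)).
Proof.
split.
  rewrite (_ : _ \o _ = (fun w => (\prod_i X i w ^+ m i)%:E)) //.
  by apply/funext => w; rewrite /= poly_rvX.
rewrite (_ : _ \o _ = cst 0%E); first exact: integrable0.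
by apply/funext => w; rewrite /= poly_rvX.
Qed.

Let integrable_poly_rv p : complex_integrable P (poly_rv X p).
Proof.
elim/mpolyind: p => [|c m p _ _ IHp].
  (* The zero polynomial is written as -1 times 1 plus 1, to fit the linear combination lemma. *)
  have := integrable_poly_rvX (@mnm0 n) => H0.
  have := complex_integrable_lin (-1) H0 H0.
  by rewrite -poly_rv_lin scaleN1r addNr.
by rewrite poly_rv_lin; apply: complex_integrable_lin.
Qed.

Definition gaussian_functional (p : B) : R[i] :=
  complex_expectation P (poly_rv X p).

Lemma gaussian_functional_is_linear : linear_for *%R gaussian_functional.
Proof.
move=> c p q; rewrite /gaussian_functional poly_rv_lin.
exact: complex_expectation_lin.
Qed.

Lemma gaussian_functionalX (m : multinom n) :
  gaussian_functional (mpolyX _ m) =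
  ((\prod_i gaussian_moment R (m i))%:C)%C.
Proof.
rewrite /gaussian_functional complex_expectationE /Rintegral.
apply/eqP; rewrite eq_complex /=; apply/andP; split; apply/eqP.
  under eq_integral => w _ do rewrite poly_rvX /=.
  by rewrite integral_monomial.
under eq_integral => w _ do rewrite poly_rvX /=.
by rewrite integral0.
Qed.

Lemma gaussian_functional1 : gaussian_functional 1 = 1.
Proof.
rewrite -mpolyX0 gaussian_functionalX big1 // => i _.
by rewrite mnm0E gaussian_moment0.
Qed.

(** By linearity monomials suffice; there the factor of index [k] obeys [gaussian_momentS] and the
    others are unchanged. *)
Lemma gaussian_functional_ibp k p :
  gaussian_functional (var k * p) = gaussian_functional (mderiv k p).
Proof.
have L0 : gaussian_functional 0 = 0.
  have := gaussian_functional_is_linear (-1) 0 0.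
  by rewrite scaler0 addr0 mulN1r addNr.
elim/mpolyind: p => [|c m p _ _ IHp].
  by rewrite mulr0 mderiv0.
rewrite mulrDr -scalerAr mderivD mderivZ !gaussian_functional_is_linear IHp.
congr (_ * _ + _).
rewrite -mpolyXD mderivX -[X in _ = gaussian_functional X]addr0.
rewrite gaussian_functional_is_linear L0 addr0 !gaussian_functionalX.
rewrite -(rmorph_nat (@real_complex R)) -rmorphM /=; congr (real_complex _ _).
rewrite (bigD1 k) //= [in RHS](bigD1 k) //= mulrA; congr (_ * _).
  by rewrite mnmDE mnm1E eqxx add1n gaussian_momentS mnmBE mnm1E eqxx subn1.
apply: eq_bigr => i ik.
by rewrite mnmDE mnmBE mnm1E eq_sym (negbTE ik) add0n subn0.
Qed.

End GaussianFunctional.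

(** * From Gaussian moments to the Jacobian Conjecture *)

Section MainReduction.
Context (R : realType).
Local Open Scope classical_set_scope.

(** Otherwise the real parts of the listed numbers would cover [0, 1], which would be countable and
    hence of Lebesgue measure 0. *)
Lemma complex_uncountable (S : nat -> seq R[i]) :
  exists c, forall j, c \notin S j.
Proof.
apply: contrapT => covered.
have cS : countable (\bigcup_j [set` map (@complex.Re R) (S j)]).
  by apply: bigcup_countable => // j _; exact/finite_set_countable/finite_seq.
have : countable `[0 : R, 1].
  apply: sub_countable cS; apply: subset_card_le => x _; apply: contrapT => xS.
  apply: covered; exists (x%:C)%C => j; apply/negP => xSj; apply: xS.
  by exists j => //=; apply/mapP; exists (x%:C)%C.
move/countable_lebesgue_measure0; rewrite lebesgue_measure_itv /= lte_fin ltr01.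
by rewrite oppr0 adde0 => -[] /eqP; rewrite oner_eq0.
Qed.

Hypothesis gmc : forall n, (1 <= n)%N -> GMC R n.

(** The point [a] is off the zeros of every nonzero [ag H m (var i)], so the vanishing at [a] that
    GMC gives for large [m] is vanishing as polynomials. *)
Lemma ag_eventually0 n (H : 'I_n -> mpoly n R[i]) : (0 < n)%N ->
  \det (1%:M - 'X *: map_mx polyC (jacobian_mx H)) = 1 ->
  forall i, exists N, forall m, (N <= m)%N -> ag H m (var i) = 0.
Proof.
move=> n0 unipotent i.
have [a Ha] := generic_point complex_uncountable (fun m => ag H m (var i)).
have [d [T [P [X [Xnormal Xindep Xint Xmom]]]]] := gaussian_space R (n + n).
pose L : {linear mpoly (n + n) R[i] -> R[i] | *%R} := HB.pack_for
  {linear mpoly (n + n) R[i] -> R[i] | *%R} (gaussian_functional X)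
  (GRing.isLinear.Build _ _ _ _ _ (gaussian_functional_is_linear Xint)).
have im2 : 'i%C * 'i%C = -1 :> R[i] by rewrite -expr2 sqr_i.
have [p [f [f1 pf]]] := @gaussian_ag R[i] 'i%C n im2 L
  (gaussian_functional1 Xmom) (gaussian_functional_ibp Xint Xmom) a H.
have expectE m q : complex_expectation P (fun w => poly_rv X p w ^+ m *
    poly_rv X q w) = L (p ^+ m * q).
  by congr complex_expectation; apply/funext => w; rewrite /poly_rv mevalM rmorphXn.
(* The hypothesis of GMC: the moments of [p] are the values at [a] of [ag H m 1], zero by [ag_1]. *)
have p0 m : (1 <= m)%N ->
    complex_expectation P (fun w => poly_rv X p w ^+ m) = 0.
  case: m => // m _; transitivity (L (p ^+ m.+1 * f 1)).
    by rewrite f1 -expectE; congr complex_expectation; apply/funext => w;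
      rewrite /poly_rv meval1 mulr1.
  by rewrite pf ag_1 // meval0.
have nn1 : (1 <= n + n)%N by rewrite addn_gt0 n0.
have [N HN] := gmc nn1 Xnormal Xindep p0 (f (var i)).
exists N => m /HN; rewrite expectE pf => agm0; apply/eqP/negPn/negP => /Ha.
by rewrite agm0 eqxx.
Qed.

End MainReduction.

Theorem theorem1p6 (R : realType) :
  (forall n : nat, (1 <= n)%N -> GMC R n) ->
  forall n : nat, (1 <= n)%N -> JC R n.
Proof.
move=> gmc n n1 F locF.
have detF v : meval v (jacobian_det F) != 0.
  by have := locF (\row_i v i); rewrite (@meval_eq _ _ _ v) // => i; rewrite mxE.
(* Vanishing nowhere, the Jacobian determinant is a nonzero constant. *)
have := nonvanishing_mpolyC (@complex_uncountable R) detF.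
apply: jacobian_const_globally_invertible => // k k0 H unipotent.
apply: unipotent_globally_invertible => //.
exact: ag_eventually0 gmc _ _ k0 unipotent.
Qed.
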